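(* There is a universal constant $\alpha>0$ such that for all $p,q\in[1,\infty)$ and for an arbitrary sequence $\mathbf f=\{f_k\}_{k=1}^\infty\subset L_p[0,1]$ of independent random variables, $$\bigl\|\,\|\mathbf f\|_{l_q}\bigr\|_{L_p}\le\alpha\Bigl(\frac{p}{\ln(p+1)}\Bigr)^{1/q}\Bigl(\bigl\|F^*\chi_{[0,1]}\bigr\|_{L_p}+\Bigl(\sum_{k=1}^\infty F^*(k)^q\Bigr)^{1/q}\Bigr).$$ Furthermore, the order $\bigl(\frac{p}{\ln(p+1)}\bigr)^{1/q}$ is optimal when $p\to\infty$: for each $q\in[1,\infty)$ there is $c>0$ not depending on $p$ such that, for all sufficiently large $p$, no constant smaller than $c\bigl(\frac{p}{\ln(p+1)}\bigr)^{1/q}$ can replace $\alpha\bigl(\frac{p}{\ln(p+1)}\bigr)^{1/q}$ in the inequality.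
   Context: Random variables are measurable functions on $[0,1]$ with Lebesgue measure. $f^*$ denotes the decreasing rearrangement of $|f|$. $\|\mathbf f\|_{l_q}$ is the function $t\mapsto\bigl(\sum_{k=1}^\infty|f_k(t)|^q\bigr)^{1/q}$. The disjointification of $\{f_k\}$ is $F=\sum_{k}\bar f_k$ on $(0,\infty)$, where the $\bar f_k$ have pairwise disjoint supports and $\bar f_k$ is equimeasurable with $f_k$ (e.g. $F(t)=\sum_{k} f_k(t-k+1)\chi_{[k-1,k]}(t)$). If the right-hand side is infinite, the inequality is vacuous. *)

(* Defs.v *)
From HB Require Import structures.
From mathcomp Require Import all_boot all_order all_algebra finmap.
From mathcomp Require Import all_classical all_reals all_analysis.

Set Implicit Arguments.
Unset Strict Implicit.
Unset Printing Implicit Defensive.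
Import Order.TTheory GRing.Theory Num.Theory.
Import numFieldNormedType.Exports.

Local Open Scope classical_set_scope.
Local Open Scope ring_scope.

(* The probability space [0, 1]: random variables are represented by functions
   on the whole line, whose values outside [0, 1] are invisible to this
   measure. *)
Definition lebesgue01 (R : realType) : set (measurableTypeR R) -> \bar R :=
  mrestr (@lebesgue_measure R) (measurable_itv `[0, 1]).
HB.instance Definition _ (R : realType) := Measure.on (@lebesgue01 R).

Lemma lebesgue01_setT (R : realType) : lebesgue01 [set: R] = 1%E.
Proof.
by rewrite /lebesgue01 /mrestr setTI lebesgue_measure_itv /= lte_fin ltr01 oppr0 adde0.
Qed.
HB.instance Definition _ (R : realType) :=
  Measure_isProbability.Build _ _ R (@lebesgue01 R) (@lebesgue01_setT R).

(* The half-line (0, +oo), with the same convention. *)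
Definition lebesgue0y (R : realType) : set (measurableTypeR R) -> \bar R :=
  mrestr (@lebesgue_measure R) (measurable_itv `]0, +oo[).
HB.instance Definition _ (R : realType) := Measure.on (@lebesgue0y R).

Section rearrangement.
Context (d : measure_display) (T : measurableType d) (R : realType).
Implicit Types (mu : {measure set T -> \bar R}) (f : T -> R).

Definition distribution_function mu f (s : R) : \bar R :=
  mu [set x | s < `|f x|].

(* Right-continuous version; the value is +oo when |f| exceeds every level on
   a set of measure more than t. *)
Definition decreasing_rearrangement mu f (t : R) : \bar R :=
  ereal_inf [set s%:E | s in
    [set s | 0 <= s /\ (distribution_function mu f s <= t%:E)%E]].

End rearrangement.

Definition equimeasurable (R : realType) d1 d2
    (T1 : measurableType d1) (T2 : measurableType d2)
    (mu1 : {measure set T1 -> \bar R}) (mu2 : {measure set T2 -> \bar R})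
    (f1 : T1 -> R) (f2 : T2 -> R) : Prop :=
  forall s : R, 0 <= s ->
    distribution_function mu1 f1 s = distribution_function mu2 f2 s.

Definition independent_variables (R : realType) d (T : measurableType d)
    (P : probability T R) (f : nat -> T -> R) : Prop :=
  forall (J : {fset nat}) (A : nat -> set R), (forall k, measurable (A k)) ->
    P (\bigcap_(k in [set` J]) (f k @^-1` A k)) =
    (\prod_(k <- J) P (f k @^-1` A k))%E.

(* F is a disjointification of f. The decreasing rearrangement of F does not
   depend on the choice of the disjoint copies fbar. *)
Definition disjointification (R : realType) (f : nat -> R -> R) (F : R -> R)
    : Prop :=
  exists fbar : nat -> R -> R,
    [/\ forall k, measurable_fun (`]0, +oo[%classic : set R) (fbar k),
        trivIset setT (fun k => [set t : R | 0 < t /\ fbar k t != 0]),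
        forall k, equimeasurable (@lebesgue0y R) (@lebesgue01 R) (fbar k) (f k)
      & forall t : R, 0 < t -> series (fun k => fbar k t) @ \oo --> F t].

Section norms.
Context (R : realType).
Implicit Types (f : nat -> R -> R) (F : R -> R) (p q : R).
Local Open Scope ereal_scope.

Definition lq_norm q f (t : R) : \bar R :=
  'N[counting]_q%:E[EFin \o f^~ t].

Definition Lp_lq_norm p q f : \bar R := 'N[@lebesgue01 R]_p%:E[lq_norm q f].

Definition disjoint_norm p q F : \bar R :=
  let Fstar := decreasing_rearrangement (@lebesgue0y R) F in
  'N[@lebesgue_measure R]_p%:E[(fun t : R => Fstar t * (\1_(`[0, 1]%classic) t)%:E)]
  + (\sum_(1 <= k <oo) Fstar k%:R `^ q) `^ q^-1.

End norms.

Definition growth_order (R : realType) (p q : R) : R :=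
  (p / ln (p + 1)) `^ q^-1.


Definition admissible (R : realType) (p : R) (f : nat -> R -> R) (F : R -> R)
    : Prop :=
  [/\ forall k, f k \in Lfun (@lebesgue01 R) p%:E,
      independent_variables (@lebesgue01 R) f
    & disjointification f F].

(* Main.v *)
Require Import Defs.
From HB Require Import structures.
From mathcomp Require Import all_boot all_order all_algebra finmap.
From mathcomp Require Import all_classical all_reals all_analysis.
From mathcomp Require Import measurable_realfun ring.
Import Order.TTheory GRing.Theory Num.Theory.
Import numFieldNormedType.Exports.
Set Implicit Arguments.
Unset Strict Implicit.
Unset Printing Implicit Defensive.
Local Open Scope classical_set_scope.
Local Open Scope ring_scope.

(** Both inequalities are proved with elementary exponential moments.

    Write r = p / q, lam = ln (p + 1), D for the distribution function of the
    disjointification F, which is the sum of the distribution functions of the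
    f_k, b = F*(1) and S for the sum of F*(k)^q over k >= 1; one may assume
    that b and S are finite.  Each |f_k| is split at the level b into a large
    and a small part.  As F* is the generalized inverse of D, the level is
    exceeded at most once on average: D(b) <= 1.  Comparing tails gives
      sum_k E (large part of f_k)^p <= || F* chi_[0,1] ||_p ^ p,
      sum_k E (small part of f_k)^q <= 2 S,
    the second because, as soon as D(s) > 1, at least D(s) / 2 integers k >= 1
    satisfy F*(k) > s ([sum_large_part_le], [sum_small_part_le]).

    It remains to bound the expectation of the r-th power of the sum of the
    q-th powers, for the large parts and for the small parts separately and
    for finitely many indices.  The only tool is
    x^r <= (r / lam)^r exp(lam x): after this the integrand is a product of
    functions of the f_k, whose expectation factors, and a variable
    Z with values in [0,1] satisfies E exp(lam Z) <= exp(p E Z), because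
    exp(lam) - 1 = p.
    - For the small parts Z_k is the q-th power of the small part of f_k,
      divided by S; it is at most 1 since b^q <= S, and the sum of the E Z_k is
      at most 2 ([small_moment_le]).
    - For the large parts, the r-th power of the sum of q-th powers is at most
      N^r times the sum of the p-th powers, N being the number of indices for
      which the level is exceeded, and N is a sum of indicators Z_k the sum of
      whose means is at most 1 ([large_moment_le]).
    The p-th roots of these two bounds have the order
    (r / lam)^(1/q) <= (p / ln (p + 1))^(1/q), up to an absolute constant.

    For the optimality take n independent indicators of probability 1 / n,
    where n is the integer part of p / ln (p + 1).  Their disjointification is
    an indicator of a set of measure one, so the disjoint norm is 1, whereas
    on the event of probability n^-n on which all of them equal 1 the l_q norm
    is n^(1/q).  Hence the L_p norm is at least n^(1/q) n^(-n/p), and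
    n^n <= exp(p) by the choice of n. *)

(** * Layer-cake formulas and comparison of tails *)

Lemma measurable_normr_gt d (T : measurableType d) (R : realType) (h : T -> R)
    (s : R) : measurable_fun setT h -> measurable [set x | s < `|h x|].
Proof.
move=> mh; rewrite -[X in measurable X]setTI.
rewrite -[[set _ | _]]/((fun x => s < `|h x|) @^-1` [set true]).
apply: (measurable_fun_ltr (measurable_cst _)) => //.
exact: (measurableT_comp (@normr_measurable R setT)).
Qed.

Section layer_cake.
Context d (T : measurableType d) (R : realType).
Variable mu : {sigma_finite_measure set T -> \bar R}.
Variables h W : T -> \bar R.
Hypotheses (mh : measurable_fun setT h) (mW : measurable_fun setT W).
Hypotheses (h0 : forall x, (0 <= h x)%E) (W0 : forall x, (0 <= W x)%E).
Local Open Scope ereal_scope.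

Let A : set (T * measurableTypeR R) := [set z | (0 <= z.2)%R /\ (z.2%:E < h z.1)].
Let phi (z : T * measurableTypeR R) := W z.1 * (\1_A z)%:E.

Let mA : measurable A.
Proof.
have -> : A = (snd @^-1` `[0%R, +oo[%classic) `&`
    (setT `&` [set z : T * measurableTypeR R | z.2%:E < h z.1]).
  by rewrite setTI; apply/seteqP; split => z; rewrite /A /= in_itv/= andbT.
apply: measurableI.
  by rewrite -[X in measurable X]setTI; exact: measurable_snd.
apply: measurable_lte => //.
  by apply/measurable_EFinP; exact: measurable_snd.
by apply: measurableT_comp => //; exact: measurable_fst.
Qed.

Let mphi : measurable_fun setT phi.
Proof.
apply: emeasurable_funM.
  by apply: measurableT_comp => //; exact: measurable_fst.
by apply/measurable_EFinP; exact: measurable_indic.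
Qed.

Let phi0 z : 0 <= phi z.
Proof. by rewrite mule_ge0 // lee_fin. Qed.

Let phiE (s : R) : s \in `[0%R, +oo[ ->
  \int[mu]_x phi (x, s) = \int[mu]_x (W x * (\1_[set y : T | (s%:E < h y)%E] x)%:E).
Proof.
rewrite in_itv/= andbT => s0; apply: eq_integral => x _; congr (_ * _%:E).
by rewrite !indicE; congr (_ %:R); congr nat_of_bool; apply/idP/idP;
  rewrite !inE /A/= => -[]//.
Qed.

Lemma measurable_layer : measurable_fun (`[0%R, +oo[%classic : set R)
  (fun s : measurableTypeR R => \int[mu]_x (W x * (\1_[set y : T | (s%:E < h y)%E] x)%:E)).
Proof.
apply: (eq_measurable_fun (fubini_G mu phi)).
  by move=> s; rewrite inE /= => /phiE.
by apply: measurable_funTS; exact: measurable_fun_fubini_tonelli_G.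
Qed.

(** Tonelli's theorem on the region under the graph of [h].  The weight [W]
    makes it possible to deduce the factorization of expectations of products
    from the factorization over the level sets of one factor. *)
Lemma weighted_layer_cake : \int[mu]_x (W x * h x) =
  \int[@lebesgue_measure R]_(s in `[0%R, +oo[)
     \int[mu]_x (W x * (\1_[set y : T | (s%:E < h y)%E] x)%:E).
Proof.
transitivity (\int[mu]_x \int[@lebesgue_measure R]_s phi (x, s)).
  apply: eq_integral => x _; rewrite /phi /=.
  have mAx : measurable [set s : measurableTypeR R | A (x, s)].
    by rewrite -[X in measurable X]setTI; exact: (pair1_measurable x measurableT mA).
  rewrite (@ge0_integralZl _ _ _ (@lebesgue_measure R) setT measurableT
    (EFin \o \1_[set s : measurableTypeR R | A (x, s)]) _ (W x))//; last 2 first.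
  - by apply/measurable_EFinP; exact: measurable_indic.
  - by move=> s _ /=; rewrite lee_fin.
  rewrite integral_indic//.
  rewrite setIT; congr (_ * _).
  case hx : (h x) (h0 x) => [y||]//=.
  - rewrite lee_fin => y0.
    have -> : (fun s => A (x, s)) = `[0%R, y[%classic.
      by apply/seteqP; split=> s; rewrite /A /= hx lte_fin in_itv/= => /andP.
    by rewrite lebesgue_measure_itv/= lte_fin oppr0 adde0; case: ltgtP y0 => // <-.
  - move=> _.
    have -> : (fun s => A (x, s)) = `[0%R, +oo[%classic.
      apply/seteqP; split=> s; rewrite /A /= hx in_itv/= andbT; first by case.
      by rewrite ltry.
    by rewrite lebesgue_measure_itv/= ltry oppr0 adde0.
have := @fubini_tonelli _ _ _ _ _ mu (@lebesgue_measure R) phi mphi phi0.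
move=> ->.
transitivity (\int[@lebesgue_measure R]_(s in `[0%R, +oo[) \int[mu]_x phi (x, s)).
  rewrite [RHS]integral_mkcond; apply: eq_integral => s _; rewrite patchE.
  case: ifPn => //; rewrite notin_setE => s0.
  apply: integral0_eq => x _; rewrite /phi indicE memNset ?mule0// /A/= => -[+ _].
  by move: s0; rewrite /= in_itv /= andbT.
by apply: eq_integral => s; rewrite inE => /phiE.
Qed.

End layer_cake.

Section tail_comparison.
Context d (T : measurableType d) d' (T' : measurableType d') (R : realType).
Local Open Scope ereal_scope.

Let integral1 dd (X : measurableType dd) (mu : {sigma_finite_measure set X -> \bar R})
    (h : X -> \bar R) (s : R) : measurable_fun setT h ->
  \int[mu]_x (1 * (\1_[set y : X | (s%:E < h y)%E] x)%:E) = mu [set y : X | s%:E < h y].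
Proof.
move=> mh; under eq_integral do rewrite mul1e.
rewrite integral_indic ?setIT//.
rewrite -[X in measurable X]setTI; apply: measurable_lte => //.
Qed.

Lemma layer_cake dd (X : measurableType dd) (mu : {sigma_finite_measure set X -> \bar R})
    (h : X -> \bar R) : measurable_fun setT h -> (forall x, 0 <= h x) ->
  \int[mu]_x h x = \int[@lebesgue_measure R]_(s in `[0%R, +oo[) mu [set y : X | (s%:E < h y)%E].
Proof.
move=> mh h0; rewrite (eq_integral (fun x => 1 * h x)); last first.
  by move=> x _; rewrite mul1e.
rewrite (@weighted_layer_cake _ _ _ _ h (cst 1))//.
by apply: eq_integral => s _; rewrite integral1.
Qed.

Lemma measurable_tail dd (X : measurableType dd) (mu : {sigma_finite_measure set X -> \bar R})
    (h : X -> \bar R) : measurable_fun setT h ->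
  measurable_fun (`[0%R, +oo[%classic : set R)
    (fun s : measurableTypeR R => mu [set y : X | (s%:E < h y)%E]).
Proof.
move=> mh; apply: eq_measurable_fun (@measurable_layer _ _ _ mu h (cst 1) mh _ _) => //.
by move=> s _; rewrite integral1.
Qed.

Let tail_poweR (X : Type) (h : X -> \bar R) (r s : R) : (0 < r)%R -> (0 <= s)%R ->
  (forall x, 0 <= h x) ->
  [set x : _ | s%:E < h x `^ r] = [set x | (s `^ r^-1)%R%:E < h x].
Proof.
move=> r0 s0 h0; apply/seteqP; split=> x /=; case: (h x) (h0 x) => [y||]//=;
  rewrite ?ltry// ?poweRyr ?gt_eqF// ?ltry// lee_fin => y0; rewrite !lte_fin => sy.
- have := @gt0_ltr_powR _ r^-1 _ s (powR y r) _ _ sy.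
  by rewrite -powRrM divff ?gt_eqF// powRr1//; apply;
    rewrite ?invr_gt0// nnegrE// powR_ge0.
- have := @gt0_ltr_powR _ r r0 _ _ _ _ sy.
  by rewrite -powRrM mulVf ?gt_eqF// powRr1//; apply;
    rewrite ?nnegrE// powR_ge0.
Qed.

(** The inequality between the tails is used at the level s^(1/r), so it
    passes to every power [r] at once. *)
Lemma tail_comparison (mu : {sigma_finite_measure set T -> \bar R})
    (nu : {sigma_finite_measure set T' -> \bar R})
    (h : nat -> T -> \bar R) (H : T' -> \bar R) (C r : R) :
  (forall k, measurable_fun setT (h k)) -> (forall k x, 0 <= h k x) ->
  measurable_fun setT H -> (forall x, 0 <= H x) -> (0 <= C)%R -> (0 < r)%R ->
  (forall s : R, (0 <= s)%R ->
     \sum_(k <oo) mu [set x : _ | s%:E < h k x] <= C%:E * nu [set x | s%:E < H x]) ->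
  \sum_(k <oo) \int[mu]_x (h k x `^ r) <= C%:E * \int[nu]_x (H x `^ r).
Proof.
move=> mh h0 mH H0 C0 r0 le_tail.
have mpow dd (X : measurableType dd) (g : X -> \bar R) : measurable_fun setT g ->
    measurable_fun setT (fun x => g x `^ r).
  by move=> mg; apply: (measurableT_comp (measurable_poweR _)).
rewrite (eq_eseriesr (g := fun k => \int[@lebesgue_measure R]_(s in `[0%R, +oo[)
    mu [set x | s%:E < h k x `^ r])); last first.
  by move=> k _; apply: (@layer_cake _ _ mu (fun x => h k x `^ r)) => [|x];
    [exact: mpow|exact: poweR_ge0].
rewrite (@layer_cake _ _ nu (fun x => H x `^ r)); [|exact: mpow|]; last first.
  by move=> ?; exact: poweR_ge0.
rewrite -integral_nneseries//; last first.
  by move=> k; apply: (@measurable_tail _ _ mu (fun x => h k x `^ r)); exact: mpow.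
rewrite -ge0_integralZl//; last first.
  by apply: (@measurable_tail _ _ nu (fun x => H x `^ r)); exact: mpow.
apply: ge0_le_integral => //.
- by move=> s _; exact: nneseries_ge0.
- apply: ge0_emeasurable_sum => //.
  by move=> k _; apply: (@measurable_tail _ _ mu (fun x => h k x `^ r)); exact: mpow.
- apply: measurable_funeM.
  by apply: (@measurable_tail _ _ nu (fun x => H x `^ r)); exact: mpow.
- move=> s /=; rewrite in_itv/= andbT => s0.
  under eq_eseriesr do rewrite tail_poweR//.
  by rewrite tail_poweR//; apply: le_tail; exact: powR_ge0.
Qed.

End tail_comparison.

(** * Expectations of products of independent variables *)

Section independence.
Context d (T : measurableType d) (R : realType) (P : probability T R).
Local Open Scope ereal_scope.

(** By the layer-cake formula for [g \o X] with weight [W], it is enough to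
    know the claim for indicators of the events defined by [X]. *)
Lemma integral_mul_indep (X : T -> R) (W : T -> \bar R) (g : R -> \bar R) :
  measurable_fun setT X -> measurable_fun setT W -> measurable_fun setT g ->
  (forall x, 0 <= W x) -> (forall y, 0 <= g y) ->
  (forall A : set R, measurable A ->
     \int[P]_x (W x * (\1_(X @^-1` A) x)%:E) = (\int[P]_x W x) * P (X @^-1` A)) ->
  \int[P]_x (W x * g (X x)) = (\int[P]_x W x) * \int[P]_x g (X x).
Proof.
move=> mX mW mg W0 g0 WX.
have mgX : measurable_fun setT (g \o X) by exact: measurableT_comp.
have W0' : 0 <= \int[P]_x W x by exact: integral_ge0.
rewrite (@weighted_layer_cake _ _ _ P (g \o X) W)//; last by move=> x; exact: g0.
rewrite (layer_cake P (h := fun x => g (X x)))//.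
rewrite -ge0_integralZl//; last exact: (@measurable_tail _ _ _ P).
apply: eq_integral => s _.
have -> : [set y | s%:E < (g \o X) y] = X @^-1` [set y | s%:E < g y] by [].
rewrite WX// -[X in measurable X]setTI.
exact: measurable_lte.
Qed.

Lemma emeasurable_prod n (h : nat -> T -> \bar R) :
  (forall i, measurable_fun setT (h i)) ->
  measurable_fun setT (fun x => \prod_(i < n) h i x).
Proof.
move=> mh; elim: n => [|n IHn].
  by under eq_fun do rewrite big_ord0; exact: measurable_cst.
by under eq_fun do rewrite big_ord_recr/=; exact: emeasurable_funM.
Qed.

Section product.
Variables (f : nat -> T -> R) (g : nat -> R -> \bar R).
Hypotheses (mf : forall k, measurable_fun setT (f k))
  (mg : forall k, measurable_fun setT (g k)) (g0 : forall k y, 0 <= g k y)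
  (indf : independent_variables P f).

Let prod_ge0 n x : 0 <= \prod_(i < n) g i (f i x).
Proof. by apply: prode_ge0 => i _. Qed.

Let mprod n : measurable_fun setT (fun x => \prod_(i < n) g i (f i x)).
Proof.
by apply: (@emeasurable_prod n (fun i x => g i (f i x))) => i; exact: measurableT_comp.
Qed.

Let cyl (J : {fset nat}) (A : nat -> set R) := \bigcap_(k in [set` J]) (f k @^-1` A k).

Let mcyl J A : (forall k, measurable (A k)) -> measurable (cyl J A).
Proof.
move=> mA; apply: fin_bigcap_measurable => // k _.
by rewrite -[X in measurable X]setTI; exact: mf.
Qed.

(** Induction on [n]: for indicators this is the hypothesis of independence,
    and each step turns one more indicator into a general factor. *)
Let integral_prod_cyl n (J : {fset nat}) (A : nat -> set R) :
  (forall k, measurable (A k)) -> (forall k, k \in J -> (n <= k)%N) ->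
  \int[P]_x ((\prod_(i < n) g i (f i x)) * (\1_(cyl J A) x)%:E) =
  (\prod_(i < n) \int[P]_x g i (f i x)) * \prod_(k <- J) P (f k @^-1` A k).
Proof.
move=> mA; elim: n J A mA => [|n IHn] J A mA Jn.
  rewrite big_ord0 mul1e -indf//.
  under eq_integral do rewrite big_ord0 mul1e.
  by rewrite integral_indic ?setIT//; exact: mcyl.
rewrite big_ord_recr/=.
have nJ : n \notin J by apply/negP => /Jn; rewrite ltnn.
pose W x := (\prod_(i < n) g i (f i x)) * (\1_(cyl J A) x)%:E.
have mW : measurable_fun setT W.
  apply: emeasurable_funM => //; apply/measurable_EFinP/measurable_indic.
  exact: mcyl.
have IW : \int[P]_x W x =
    (\prod_(i < n) \int[P]_x g i (f i x)) * \prod_(k <- J) P (f k @^-1` A k).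
  by apply: IHn => // k /Jn /ltnW.
transitivity (\int[P]_x (W x * g n (f n x))).
  by apply: eq_integral => x _; rewrite /W big_ord_recr/= muleAC.
rewrite (@integral_mul_indep (f n) W (g n))//.
- by rewrite IW muleAC.
- by move=> x; rewrite mule_ge0// lee_fin.
move=> B mB; rewrite IW.
pose A' k := if k == n then B else A k.
have mA' k : measurable (A' k) by rewrite /A'; case: ifP.
transitivity (\int[P]_x ((\prod_(i < n) g i (f i x)) * (\1_(cyl (n |` J)%fset A') x)%:E)).
  apply: eq_integral => x _; rewrite /W -muleA -EFinM; congr (_ * _%:E).
  rewrite -[LHS]/((\1_(cyl J A) \* \1_(f n @^-1` B))%R x) -indicI !indicE.
  congr (_ %:R); congr nat_of_bool; apply/idP/idP; rewrite !inE.
  - move=> [Jx Bx] k /=; rewrite !inE /A' => /orP[/eqP->|kJ]; first by rewrite eqxx.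
    by case: eqP kJ nJ => [-> ->//|_ kJ _]; exact: Jx.
  - move=> Jx; split; last first.
      by have := Jx n; rewrite /A' eqxx; apply; rewrite /= !inE eqxx.
    move=> k kJ; have := Jx k; rewrite /A'.
    case: eqP kJ nJ => [-> /= ->//|_ kJ _]; apply.
    by rewrite /= !inE kJ orbT.
rewrite IHn//; last by move=> k; rewrite !inE => /orP[/eqP->//|/Jn/ltnW].
rewrite big_fsetU1//= /A' eqxx [X in _ * X]muleC muleA; congr (_ * _ * _).
rewrite !big_seq; apply: eq_bigr => k kJ.
by case: eqP kJ nJ => // -> ->.
Qed.

Lemma integral_prod_independent n :
  \int[P]_x (\prod_(i < n) g i (f i x)) = \prod_(i < n) \int[P]_x g i (f i x).
Proof.
transitivity (\int[P]_x ((\prod_(i < n) g i (f i x)) * (\1_(cyl fset0 (fun=> set0)) x)%:E)).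
  apply: eq_integral => x _; rewrite indicE mem_set ?mule1//.
by rewrite integral_prod_cyl// big_seq_fset0 mule1.
Qed.

End product.
End independence.

(** * Distribution function and rearrangement of a disjointification *)

Section disjoint_tail.
Context (R : realType) (f : nat -> R -> R) (F : R -> R).
Hypothesis Ff : disjointification f F.
Local Open Scope ereal_scope.
Local Notation halfline := (`]0%R, +oo[%classic : set R).

Let Fset (s : R) := [set t : R | (s < `|F t|)%R] `&` halfline.

(** [F] itself need not be measurable on the whole line; its level sets in the
    half-line are nevertheless disjoint unions of level sets of the copies. *)
Let disjointification_tail : exists A : nat -> R -> set R,
  [/\ forall s, (0 <= s)%R -> Fset s = \bigcup_k A k s,
      forall k s, measurable (A k s),
      forall s, (0 <= s)%R -> trivIset setT (A ^~ s) &
      forall k s, (0 <= s)%R ->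
        @lebesgue_measure R (A k s) = @lebesgue01 R [set t | (s < `|f k t|)%R]].
Proof.
have [fbar [mfbar tfbar efbar cfbar]] := Ff.
(* At a point of the half-line at most one term of the series is non-zero. *)
have FE k t : (0 < t)%R -> fbar k t != 0%R -> F t = fbar k t.
  move=> t0 fk0; apply: (cvg_unique _ (cfbar t t0)) => //.
  apply: cvg_near_cst; near=> n.
  rewrite /series/= (bigD1_seq k)/= ?iota_uniq ?mem_index_iota//; last first.
    by near: n; exact: nbhs_infty_gt.
  rewrite big1 ?addr0// => j jk; apply/eqP; apply: contrapT => /negP fj0.
  have := tfbar j k I I; move: jk => /eqP + H; apply; apply: H.
  by exists t.
exists (fun k s => [set t : R | (s < `|fbar k t|)%R] `&` halfline); split.
- move=> s s0; apply/seteqP; split=> t.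
  + move=> [/= sF]; rewrite in_itv/= andbT => t0.
    apply: contrapT => nA.
    have fbar0 k : fbar k t = 0%R.
      apply/eqP; apply: contrapT => /negP /(FE _ _ t0) Fk.
      by apply: nA; exists k => //; split => /=; rewrite -?Fk// in_itv/= t0.
    move: sF; have -> : F t = 0%R.
      apply: (cvg_unique _ (cfbar t t0)) => //; apply: cvg_near_cst.
      by apply: nearW => n; rewrite /series/= big1.
    by rewrite normr0 ltNge s0.
  + move=> [k _ [/= sk]]; rewrite in_itv/= andbT => t0.
    have fk0 : fbar k t != 0%R.
      by apply: contraTneq sk => ->; rewrite normr0 -leNgt.
    by split; rewrite /= ?(FE _ _ t0 fk0)// in_itv/= t0.
- move=> k s; rewrite setIC.
  have := mfbar k; move=> /(_ (measurable_itv _)).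
  have mabs : measurable [set y : R | (s < `|y|)%R].
    by apply: (@measurable_normr_gt _ R R id); exact: measurable_id.
  by move=> /(_ _ mabs).
- move=> s s0; apply/trivIsetP => i j _ _ ij; apply/seteqP; split => // t.
  move=> [[/= si]]; rewrite in_itv/= andbT => t0 [/= sj _].
  move/eqP: ij; apply; apply: (tfbar i j I I); exists t; split; split=> //.
    by apply: contraTneq si => ->; rewrite normr0 -leNgt.
  by apply: contraTneq sj => ->; rewrite normr0 -leNgt.
- move=> k s s0; exact: (efbar k s s0).
Unshelve. all: by end_near. Qed.

Let D := distribution_function (@lebesgue0y R) F.
Let Fstar := decreasing_rearrangement (@lebesgue0y R) F.

Let mFset s : (0 <= s)%R -> measurable (Fset s).
Proof.
move=> s0; have [A [FA mA _ _]] := disjointification_tail.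
by rewrite FA//; exact: bigcup_measurable.
Qed.

Lemma disjointification_distribution s : (0 <= s)%R ->
  D s = \sum_(k <oo) distribution_function (@lebesgue01 R) (f k) s.
Proof.
move=> s0; have [A [FA mA tA eA]] := disjointification_tail.
rewrite /D /distribution_function /= -[LHS]/(@lebesgue_measure R (Fset s)).
rewrite FA// measure_bigcup; [|by move=> k _; exact: mA|exact: tA].
by rewrite eseries_mkcond; apply: eq_eseriesr => k _; rewrite in_setT; exact: eA.
Qed.

Lemma distribution_nonincreasing s u : (0 <= s)%R -> (s <= u)%R -> D u <= D s.
Proof.
move=> s0 su; rewrite /D /distribution_function.
rewrite -[leLHS]/(@lebesgue_measure R (Fset u)) -[leRHS]/(@lebesgue_measure R (Fset s)).
apply: le_measure; rewrite ?inE; [exact: mFset (le_trans s0 su)|exact: mFset|].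
by move=> t [/= ut t0]; split => //=; exact: le_lt_trans su ut.
Qed.

(** Right continuity, from the continuity of the measure along the increasing
    level sets above s + 1 / (n + 1). *)
Let distribution_right_gt s t : (0 <= s)%R -> t < D s -> exists2 u, (s < u)%R & t < D u.
Proof.
move=> s0 tD; pose v n : R := (s + n.+1%:R^-1)%R.
have v0 n : (0 <= v n)%R by rewrite addr_ge0// invr_ge0 ler0n.
have cvgD : @lebesgue_measure R \o (Fset \o v) @ \oo --> D s.
  have -> : D s = @lebesgue_measure R (\bigcup_n (Fset \o v) n).
    rewrite -[LHS]/(@lebesgue_measure R (Fset s)); congr lebesgue_measure.
    apply/seteqP; split => x.
      move=> [/= sx x0].
      have [k kx] := ltr_add_invr sx.
      by exists k => //; split.
    move=> [n _ [/= vx x0]]; split => //=; apply: le_lt_trans vx.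
    by rewrite lerDl invr_ge0 ler0n.
  apply: nondecreasing_cvg_mu.
  - by move=> n; exact: mFset.
  - by apply: bigcup_measurable => n _; exact: mFset.
  - move=> n m nm; apply/subsetPset => x [/= vx x0]; split => //=.
    apply: le_lt_trans vx; rewrite lerD2l lef_pV2 ?posrE ?ltr0n//.
    by rewrite ler_nat ltnS.
apply: contrapT => nex.
have : D s <= t.
  rewrite -(cvg_lim _ cvgD)//; apply: lime_le; first by apply/cvg_ex; exists (D s).
  apply: nearW => n /=; rewrite leNgt; apply/negP => tv; apply: nex.
  by exists (v n) => //; rewrite ltrDl invr_gt0 ltr0n.
by rewrite leNgt tD.
Qed.

(** The rearrangement is the generalized inverse of the distribution function;
    the strict inequality on the left requires right continuity. *)
Lemma rearrangement_gt s t : (0 <= s)%R -> (s%:E < Fstar t) = (t%:E < D s).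
Proof.
move=> s0; apply/idP/idP.
- rewrite !ltNge; apply: contra => Ds.
  by apply: ereal_inf_lbound; exists s.
- move=> /(distribution_right_gt s0)[u su tDu].
  apply: (@lt_le_trans _ _ u%:E); first by rewrite lte_fin.
  apply: le_ereal_inf_tmp => _ [w [w0 Dw] <-]; rewrite lee_fin leNgt; apply/negP => wu.
  have := distribution_nonincreasing w0 (ltW wu).
  by move=> /(lt_le_trans tDu); rewrite ltNge Dw.
Qed.

Lemma rearrangement_ge0 t : 0 <= Fstar t.
Proof. by apply: le_ereal_inf_tmp => _ [s [s0 _] <-]; rewrite lee_fin. Qed.

End disjoint_tail.

(** * Splitting at the level F*(1) *)

Section truncation.
Context (R : realType).

Definition large_part (b y : R) : R := if b < `|y| then `|y| else 0.
Definition small_part (b y : R) : R := if b < `|y| then 0 else `|y|.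

Lemma large_part_ge0 b y : 0 <= large_part b y.
Proof. by rewrite /large_part; case: ifP. Qed.

Lemma small_part_ge0 b y : 0 <= small_part b y.
Proof. by rewrite /small_part; case: ifP. Qed.

Lemma small_part_le b y : 0 <= b -> small_part b y <= b.
Proof. by rewrite /small_part => b0; case: ltP. Qed.

Lemma large_part_gt b y s : 0 <= s -> (s < large_part b y) = (Num.max s b < `|y|).
Proof.
rewrite /large_part gt_max => s0; case: ifP; rewrite ?andbT ?andbF// => _.
by rewrite ltNge s0.
Qed.

Lemma measurable_large_part b : measurable_fun setT (large_part b).
Proof.
apply: measurable_fun_if => //.
by apply: measurable_fun_ltr => //; exact: normr_measurable.
Qed.

Lemma measurable_small_part b : measurable_fun setT (small_part b).
Proof.
apply: measurable_fun_if => //.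
by apply: measurable_fun_ltr => //; exact: normr_measurable.
Qed.

End truncation.

(* This makes the comparison of tails applicable to a series. *)
HB.instance Definition _ (R : realType) :=
  Measure_isSigmaFinite.Build _ nat R (@counting nat R) (sigma_finite_counting R).

Section rearrangement_sums.
Context (R : realType) (f : nat -> R -> R) (F : R -> R).
Hypothesis mf : forall k, measurable_fun (setT : set R) (f k).
Hypothesis Ff : disjointification f F.
Local Open Scope ereal_scope.
Let D := distribution_function (@lebesgue0y R) F.
Let Fstar := decreasing_rearrangement (@lebesgue0y R) F.
Let H (t : R) : \bar R := Fstar t * (\1_(`[0%R, 1%R]%classic) t)%:E.

Let H0 t : 0 <= H t.
Proof. by rewrite mule_ge0 ?rearrangement_ge0// lee_fin. Qed.

Let H_gt s t : (0 <= s)%R -> (s%:E < H t) = (t \in `[0%R, 1%R]) && (t%:E < D s).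
Proof.
move=> s0; rewrite /H indicE; case: (boolP (t \in `[0%R, 1%R])) => t01 /=.
  by rewrite mem_set// mule1 (rearrangement_gt Ff).
by rewrite memNset ?mule0 ?lte_fin ?ltNge ?s0//; exact/negP.
Qed.

Lemma measurable_rearrangement01 : measurable_fun (setT : set R) H.
Proof.
move=> _; apply: (measurability _ (ErealGenOInfty.measurableE R)) => //.
move=> /= _ [_ [a ->]] <-; rewrite setTI preimage_itvoy.
have [a0|a0] := leP 0%R a; last first.
  rewrite (_ : [set _ | _] = setT)//; apply/seteqP; split => // t _ /=.
  by rewrite (lt_le_trans _ (H0 t))// lte_fin.
rewrite (_ : [set _ | _] = `[0%R, 1%R] `&` [set t | t%:E < D a]); last first.
  by apply/seteqP; split => t /=; rewrite H_gt//; [move/andP|move=> ?; apply/andP].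
apply: measurableI => //.
rewrite -[X in measurable X]setTI; exact: measurable_lte.
Qed.

Section level.
Variable b : R.
Hypothesis Fb : Fstar 1%R = b%:E.

Let b0 : (0 <= b)%R.
Proof. by rewrite -lee_fin -Fb rearrangement_ge0. Qed.

Lemma distribution_level_le1 : D b <= 1.
Proof. by rewrite leNgt -(rearrangement_gt Ff)// -/Fstar Fb ltxx. Qed.

(** The tail of the large parts is D(max(s,b)) <= min(1, D(s)), and the latter is
    the measure of the subset of [0,1] on which F* > s. *)
Lemma sum_large_part_le (p : R) : (0 < p)%R ->
  \sum_(k <oo) \int[@lebesgue01 R]_x ((large_part b (f k x))%:E `^ p) <=
  \int[@lebesgue_measure R]_x (H x `^ p).
Proof.
move=> p0; rewrite -[leRHS]mul1e.
apply: (@tail_comparison _ _ _ _ _ (@lebesgue01 R) (@lebesgue_measure R)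
  (fun k x => (large_part b (f k x))%:E)) => //.
- move=> k; apply/measurable_EFinP.
  by apply: (measurableT_comp (measurable_large_part b)); exact: mf.
- by move=> k x; rewrite lee_fin large_part_ge0.
- exact: measurable_rearrangement01.
move=> s s0; rewrite mul1e.
have m0 : (0 <= Num.max s b)%R by rewrite le_max s0.
rewrite (_ : \sum_(k <oo) _ = D (Num.max s b)); last first.
  rewrite /D (disjointification_distribution Ff)//.
  apply: eq_eseriesr => k _; congr (lebesgue01 _); apply/seteqP.
  by split=> x /=; rewrite lte_fin large_part_gt.
have Dm1 : D (Num.max s b) <= 1.
  apply: le_trans distribution_level_le1.
  by apply: (distribution_nonincreasing Ff) => //; rewrite le_max lexx orbT.
have Dms : D (Num.max s b) <= D s.
  by apply: (distribution_nonincreasing Ff) => //; rewrite le_max lexx.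
have mHs : measurable [set x : measurableTypeR R | s%:E < H x].
  rewrite -[X in measurable X]setTI; apply: measurable_lte => //.
  exact: measurable_rearrangement01.
have [y [y0 y1 yDs Dmy]] : exists y : R,
    [/\ (0 <= y)%R, (y <= 1)%R, y%:E <= D s & D (Num.max s b) <= y%:E].
  have Dm0 : 0 <= D (Num.max s b) by exact: measure_ge0.
  exists (fine (D (Num.max s b))).
  have Dfin : D (Num.max s b) \is a fin_num.
    by rewrite ge0_fin_numE// (le_lt_trans Dm1)// ltry.
  by rewrite -!lee_fin !fineK.
apply: (le_trans Dmy).
have <- : @lebesgue_measure R `[0%R, y[%classic = y%:E.
  rewrite lebesgue_measure_itv/= lte_fin oppr0 adde0.
  by move: y0; rewrite le_eqVlt => /predU1P[<-|->]; rewrite ?ltxx.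
apply: le_measure; rewrite ?inE//.
move=> x /=; rewrite in_itv/= => /andP[x0 xy]; rewrite H_gt// in_itv/= x0/=.
rewrite (ltW (lt_le_trans xy y1))/=; apply: lt_le_trans yDs.
by rewrite lte_fin.
Qed.

(** F*(k) > s means k < D(s).  Since D(s) > 1, the number of such k >= 1, which
    is the integer n >= 1 with n < D(s) <= n + 1, is at least half of D(s). *)
Let tail_count s : (0 <= s)%R -> (s < b)%R ->
  D s <= 2%:E * counting [set k : nat | (0 < k)%N /\ s%:E < Fstar k%:R].
Proof.
move=> s0 sb; set A := [set _ | _].
have D1 : 1 < D s by rewrite -(rearrangement_gt Ff)// -/Fstar Fb lte_fin.
have cntA n : n%:R%:E < D s -> n%:R%:E <= @counting nat R A.
  move=> nD; apply: (@le_trans _ _ (\sum_(1 <= k < n.+1) (\1_A k)%:E)).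
    rewrite (eq_big_nat _ _ (F2 := fun=> 1)).
      by rewrite sumEFin big_const_nat subSS subn0 iter_addr_0.
    move=> k /andP[k0 kn]; rewrite indicE mem_set//; split => //.
    rewrite (rearrangement_gt Ff)//; apply: le_lt_trans nD.
    by rewrite lee_fin ler_nat -ltnS.
  have -> : @counting nat R A = \sum_(k <oo) (\1_A k)%:E.
    transitivity (\int[@counting nat R]_k (\1_A k)%:E).
      by rewrite integral_indic// setIT.
    by rewrite ge0_integral_count// => k; rewrite lee_fin.
  rewrite (@nneseries_split _ _ 0 1)//.
  apply: (le_trans (@nneseries_lim_ge R _ xpredT 1 n.+1 _)).
    by move=> k _ _; rewrite lee_fin.
  by rewrite add0n leeDr// sume_ge0// => k _; rewrite lee_fin.
have [[y Dy]|Dy] : (exists y, D s = y%:E) \/ D s = +oo.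
- by case: (D s) D1 => [y _|_|//]; [left; exists y|right].
- have exn : exists n, (y <= n.+1%:R)%R.
    by exists (Num.truncn y); rewrite ltW// truncnS_gt.
  case: (ex_minnP exn) => n yn nmin.
  have n0 : (0 < n)%N.
    by rewrite lt0n; apply/eqP => n0; move: yn D1; rewrite n0 Dy lte_fin leNgt => /negP.
  have ny : (n%:R < y)%R.
    rewrite ltNge; apply/negP; rewrite -{1}(prednK n0) => /nmin.
    by rewrite -ltnS prednK// ltnn.
  apply: (@le_trans _ _ (2%:E * n%:R%:E)).
    rewrite Dy -EFinM lee_fin (le_trans yn)// -natrM ler_nat mul2n -addnn.
    by rewrite -addn1 leq_add2l.
  by rewrite lee_pmul2l// cntA// Dy lte_fin.
- suff -> : @counting nat R A = +oo by rewrite Dy muleC gt0_mulye ?lte_fin.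
  apply/eqyP => e e0; apply: (@le_trans _ _ ((Num.truncn e).+1%:R%:E)).
    by rewrite lee_fin ltW// truncnS_gt.
  by apply: cntA; rewrite Dy ltry.
Qed.

Lemma sum_small_part_le (q : R) : (0 < q)%R ->
  \sum_(k <oo) \int[@lebesgue01 R]_x ((small_part b (f k x))%:E `^ q) <=
  2%:E * \sum_(1 <= k <oo) (Fstar k%:R `^ q).
Proof.
move=> q0; pose G k := if (0 < k)%N then Fstar k%:R else 0.
have G0 k : 0 <= G k by rewrite /G; case: ifP => // _; exact: rearrangement_ge0.
rewrite (_ : \sum_(1 <= k <oo) _ = \int[counting]_k (G k `^ q)); last first.
  rewrite ge0_integral_count; last by move=> k; exact: poweR_ge0.
  rewrite eseries_cond eseries_mkcondr; apply: eq_eseriesr => k _.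
  by rewrite /G; case: ifP => // _; rewrite poweR0r// gt_eqF.
have := @tail_comparison _ _ _ nat R (@lebesgue01 R) (@counting nat R)
  (fun k x => (small_part b (f k x))%:E) G 2 q.
apply => //.
- move=> k; apply/measurable_EFinP.
  by apply: (measurableT_comp (measurable_small_part b)); exact: mf.
- by move=> k x; rewrite lee_fin small_part_ge0.
move=> s s0.
have [sb|bs] := ltP s b; last first.
  rewrite eseries0 ?mule_ge0// => k _ _.
  rewrite (_ : [set _ | _] = set0) ?measure0//; apply/seteqP; split => // x /=.
  by rewrite lte_fin ltNge (le_trans (small_part_le _ b0)).
rewrite (_ : [set x | s%:E < G x] = [set k : nat | (0 < k)%N /\ s%:E < Fstar k%:R]); last first.
  apply/seteqP; split=> k; rewrite /G/=; last by case=> ->.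
  by case: ifP => // _; rewrite lte_fin ltNge s0.
apply: le_trans (tail_count s0 sb).
rewrite /D (disjointification_distribution Ff)//.
apply: lee_nneseries => [k _ _|k _]; first exact: measure_ge0.
apply: le_measure; rewrite ?inE.
- rewrite -[X in measurable X]setTI; apply: measurable_lte => //.
  apply/measurable_EFinP.
  by apply: (measurableT_comp (measurable_small_part b)); exact: mf.
- by apply: measurable_normr_gt; exact: mf.
- by move=> x /=; rewrite lte_fin /small_part; case: ifP => // _; rewrite ltNge s0.
Qed.

End level.
End rearrangement_sums.

(** * Elementary inequalities and exponential moments *)

Section real_inequalities.
Context (R : realType).
Implicit Types x y lam r p : R.

(** With u = lam x / r this is u <= exp(u), raised to the power [r]. *)
Lemma powR_le_expR lam r x : 0 < lam -> 0 < r -> 0 <= x ->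
  x `^ r <= (r / lam) `^ r * expR (lam * x).
Proof.
move=> lam0 r0 x0.
have u0 : 0 <= lam * x / r by rewrite divr_ge0 ?mulr_ge0// ltW.
have -> : x = (r / lam) * (lam * x / r).
  by field; rewrite !gt_eqF.
rewrite powRM//; last by rewrite divr_ge0// ltW.
rewrite ler_wpM2l ?powR_ge0//.
have -> : lam * (r / lam * (lam * x / r)) = (lam * x / r) * r.
  by field; rewrite !gt_eqF.
rewrite expRM ge0_ler_powR ?nnegrE ?expR_ge0 ?(ltW r0)//.
by apply: le_trans (expR_ge1Dx _); rewrite lerDr.
Qed.

Lemma expR_chord lam y : 0 <= y <= 1 -> expR (lam * y) <= 1 + y * (expR lam - 1).
Proof.
move=> /andP[y0 y1]; have := convex_expR (Itv01 y0 y1) lam 0.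
rewrite !convRE /= expR0 !mulr0 addr0 mulr1 [lam * y]mulrC => /le_trans; apply.
by rewrite le_eqVlt /unstable.onem; apply/orP; left; apply/eqP; ring.
Qed.

Lemma powRD_le r x y : 0 <= r -> 0 <= x -> 0 <= y ->
  (x + y) `^ r <= 2 `^ r * (x `^ r + y `^ r).
Proof.
move=> r0; wlog xy : x y / x <= y.
  move=> H x0 y0; have [/H->//|/ltW/H] := leP x y.
  by rewrite addrC [X in _ * X]addrC; apply.
move=> x0 y0; apply: (@le_trans _ _ (2 `^ r * y `^ r)).
  rewrite -powRM// ge0_ler_powR// ?nnegrE ?addr_ge0 ?mulr_ge0//.
  by rewrite mulr_natl mulr2n lerD2r.
by rewrite ler_wpM2l ?powR_ge0// lerDr powR_ge0.
Qed.

(** Both power sums are compared with the largest term: with N non-zero terms,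
    the sum of the q-th powers is at most N times the q-th power of that term.
    This crude form holds for p < q as well as for p >= q. *)
Lemma powR_sum_le n (a : 'I_n -> R) (q p : R) (A : pred 'I_n) : 0 < q -> 0 < p ->
  (forall i, 0 <= a i) -> (forall i, ~~ A i -> a i = 0) ->
  (\sum_(i < n) a i `^ q) `^ (p / q) <=
  (\sum_(i < n) (A i)%:R) `^ (p / q) * \sum_(i < n) a i `^ p.
Proof.
move=> q0 p0 a0 aA.
have [/forallP a_eq0|/forallPn[i0 _]] := boolP [forall i, a i == 0].
  rewrite big1; last by move=> i _; rewrite (eqP (a_eq0 i)) powR0// gt_eqF.
  rewrite powR0 ?mulr_ge0 ?powR_ge0 ?sumr_ge0// => [i _|]; first exact: powR_ge0.
  by rewrite gt_eqF// divr_gt0.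
have [m _ am] := @arg_maxP _ _ _ i0 xpredT a isT.
have pq0 : 0 < p / q by rewrite divr_gt0.
apply: (@le_trans _ _ (((\sum_(i < n) (A i)%:R) * a m `^ q) `^ (p / q))).
  rewrite ge0_ler_powR ?nnegrE ?(ltW pq0) ?mulr_ge0 ?powR_ge0 ?sumr_ge0//.
    by move=> i _; exact: powR_ge0.
  rewrite mulr_suml; apply: ler_sum => i _.
  have [Ai|/aA ->] := boolP (A i); last by rewrite mul0r powR0// gt_eqF.
  rewrite mul1r ge0_ler_powR ?nnegrE ?(ltW q0)//.
  exact: am.
rewrite powRM ?powR_ge0 ?sumr_ge0// -powRrM mulrC.
have -> : q * (p / q) = p by field; rewrite gt_eqF.
rewrite mulrC ler_wpM2l ?powR_ge0// (bigD1 m)//= lerDl sumr_ge0// => i _.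
exact: powR_ge0.
Qed.

End real_inequalities.

Section exponential_moments.
Context d (T : measurableType d) (R : realType) (P : probability T R).
Local Open Scope ereal_scope.

(** The exponential lies below its chord on [0,lam], and 1 + x <= exp(x). *)
Lemma exp_moment_le (Z : T -> R) (lam m : R) : measurable_fun setT Z ->
  (forall x, 0 <= Z x <= 1)%R -> (0 <= lam)%R -> \int[P]_x (Z x)%:E <= m%:E ->
  \int[P]_x (expR (lam * Z x))%:E <= (expR ((expR lam - 1) * m))%:E.
Proof.
move=> mZ Z01 lam0 Zm.
have c0 : (0 <= expR lam - 1)%R by rewrite subr_ge0 -[leLHS]expR0 ler_expR.
have Z0 x : (0 <= Z x)%R by case/andP: (Z01 x).
apply: (@le_trans _ _ (\int[P]_x (1 + (expR lam - 1)%:E * (Z x)%:E))).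
  apply: ge0_le_integral => //.
  - by apply/measurable_EFinP; apply: measurableT_comp => //; exact: measurable_funM.
  - apply: emeasurable_funD => //; apply: emeasurable_funM => //.
    exact/measurable_EFinP.
  - by move=> x _; rewrite -EFinM -EFinD lee_fin [X in (_ <= 1 + X)%R]mulrC expR_chord.
rewrite ge0_integralD//; last 2 first.
- by move=> x _; rewrite mule_ge0// lee_fin.
- by apply: emeasurable_funM => //; exact/measurable_EFinP.
have -> : \int[P]__ 1 = 1 by rewrite integral_cst// mul1e; exact: probability_setT.
rewrite ge0_integralZl//; last 2 first.
- exact/measurable_EFinP.
- by move=> x _; rewrite lee_fin.
apply: (@le_trans _ _ (1 + (expR lam - 1)%:E * m%:E)).
  by rewrite leeD2l// lee_wpmul2l.
by rewrite -EFinM -EFinD lee_fin expR_ge1Dx.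
Qed.

Lemma lee_prod n (a b : 'I_n -> \bar R) :
  (forall i, 0 <= a i <= b i) -> \prod_(i < n) a i <= \prod_(i < n) b i.
Proof.
move=> ab; suff: 0 <= \prod_(i < n) a i <= \prod_(i < n) b i by case/andP.
elim/big_rec2 : _ => [|i x y _ /andP[y0 yx]]; first by rewrite lee01 lexx.
have /andP[ai abi] := ab i.
by rewrite mule_ge0//= lee_pmul.
Qed.

End exponential_moments.

(** * Moments of the two parts *)

Section truncated_moments.
Context d (T : measurableType d) (R : realType) (P : probability T R).
Variables (f : nat -> T -> R) (p q b : R).
Hypotheses (mf : forall k, measurable_fun setT (f k))
  (indf : independent_variables P f).
Hypotheses (p1 : 1 <= p) (q1 : 1 <= q) (b0 : 0 <= b).
Let lam : R := ln (p + 1).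
Let r : R := p / q.
Local Open Scope ereal_scope.

Let p0 : (0 < p)%R. Proof. exact: lt_le_trans p1. Qed.
Let q0 : (0 < q)%R. Proof. exact: lt_le_trans q1. Qed.
Let r0 : (0 < r)%R. Proof. by rewrite divr_gt0. Qed.
Let lam0 : (0 < lam)%R. Proof. by rewrite ln_gt0// ltrDr. Qed.
Let explam : expR lam = (p + 1)%R.
Proof. by rewrite lnK// posrE addr_gt0. Qed.

Let mindic : measurable_fun setT (fun y : R => (b < `|y|)%R%:R : R).
Proof.
rewrite (_ : (fun _ => _) = \1_[set y : R | (b < `|y|)%R]); last first.
  by apply/funext => y; rewrite indicE mem_setE.
by apply: measurable_indic; exact: measurable_normr_gt.
Qed.

Let mlarge k : measurable_fun setT (fun x => large_part b (f k x)).
Proof. by apply: (measurableT_comp (measurable_large_part b)). Qed.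

Let msmall k : measurable_fun setT (fun x => small_part b (f k x)).
Proof. by apply: (measurableT_comp (measurable_small_part b)). Qed.

(** For fixed [k], the product over [i] of these functions of the [f i] is
    exp(lam N) times the p-th power of the large part of [f k], where N is the
    number of indices for which the level is exceeded. *)
Let weightR (k i : nat) (y : R) : R :=
  (expR (lam * (b < `|y|)%R%:R) * (if i == k then large_part b y `^ p else 1))%R.

Let weight (k i : nat) (y : R) : \bar R := (weightR k i y)%:E.

Let mweight k i : measurable_fun setT (weight k i).
Proof.
apply/measurable_EFinP; apply: measurable_funM.
  by apply: measurableT_comp => //; exact: measurable_funM.
case: (i == k) => //.
exact: (measurableT_comp (measurable_powR _) (measurable_large_part b)).
Qed.

Let weight_ge0 k i y : 0 <= weight k i y.
Proof.
by rewrite lee_fin mulr_ge0 ?expR_ge0//; case: ifP => // _; exact: powR_ge0.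
Qed.

Let exceed i := fine (P [set x | (b < `|f i x|)%R]).

Let mexceed i : measurable [set x | (b < `|f i x|)%R].
Proof. exact: measurable_normr_gt. Qed.

Let exceedE i : (exceed i)%:E = P [set x | (b < `|f i x|)%R].
Proof. by rewrite fineK// fin_num_measure. Qed.

(** For [i = k] the exponential equals exp(lam) = p + 1 wherever the large part is
    non-zero, so it costs only a factor p + 1; the remaining factors are
    exponential moments of indicators. *)
Let integral_weight k i :
  \int[P]_x weight k i (f i x) <= (expR (p * exceed i))%:E *
    (if i == k then (p + 1)%:E * \int[P]_x (large_part b (f k x) `^ p)%:E else 1).
Proof.
have e0 j : (0 <= exceed j)%R by rewrite fine_ge0.
have [->|/negbTE ik] := eqVneq i k; rewrite /weight /weightR ?eqxx ?ik.
  apply: (@le_trans _ _ ((p + 1)%:E * \int[P]_x (large_part b (f k x) `^ p)%:E)).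
    rewrite -ge0_integralZl//; last 3 first.
    - by apply/measurable_EFinP; exact: (measurableT_comp (measurable_powR _) (mlarge k)).
    - by move=> x _; rewrite lee_fin powR_ge0.
    - by rewrite lee_fin addr_ge0// ltW.
    rewrite le_eqVlt; apply/orP; left; apply/eqP; apply: eq_integral => x _.
    rewrite -EFinM /large_part; case: ifP => _; first by rewrite mulr1 explam.
    by rewrite powR0 ?mulr0// gt_eqF.
  rewrite -[leLHS]mul1e lee_wpmul2r//; last first.
    by rewrite lee_fin -[leLHS]expR0 ler_expR mulr_ge0// ltW.
  rewrite mule_ge0//; first by rewrite lee_fin addr_ge0// ltW.
  by apply: integral_ge0 => x _; rewrite lee_fin powR_ge0.
rewrite mule1; under eq_integral do rewrite mulr1.
rewrite -[X in (X * exceed i)%R](addrK 1%R) -explam.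
apply: exp_moment_le => //; [exact: (measurableT_comp mindic)| |exact: ltW|].
  by move=> x; case: (b < _)%R; rewrite ?lexx ?ler01.
rewrite exceedE -[X in P X]setIT -integral_indic//.
rewrite le_eqVlt; apply/orP; left; apply/eqP; apply: eq_integral => x _.
by rewrite indicE mem_setE.
Qed.

Lemma large_moment_le n : \sum_(i < n) P [set x | (b < `|f i x|)%R] <= 1 ->
  \int[P]_x ((\sum_(i < n) large_part b (f i x) `^ q) `^ r)%R%:E <=
  ((r / lam) `^ r * ((p + 1) * expR p))%R%:E *
  \sum_(k < n) \int[P]_x (large_part b (f k x) `^ p)%:E.
Proof.
move=> Pb1.
have mprod k : measurable_fun setT (fun x => \prod_(i < n) weight k i (f i x)).
  apply: (@emeasurable_prod _ _ _ n (fun i x => weight k i (f i x))) => i.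
  exact: measurableT_comp.
apply: (@le_trans _ _ (\int[P]_x (((r / lam) `^ r)%:E *
    \sum_(k < n) \prod_(i < n) weight k i (f i x)))).
  apply: ge0_le_integral => //.
  - by move=> x _; rewrite lee_fin powR_ge0.
  - apply/measurable_EFinP; apply: (measurableT_comp (measurable_powR _)).
    apply: measurable_sum => i.
    exact: (measurableT_comp (measurable_powR _) (mlarge i)).
  - by apply: emeasurable_funM => //; exact: emeasurable_sum.
  move=> x _.
  rewrite (eq_bigr (fun k : 'I_n => (\prod_(i < n) weightR k i (f i x))%R%:E));
    last by move=> k _; rewrite -prodEFin.
  rewrite sumEFin -EFinM lee_fin.
  apply: le_trans (@powR_sum_le R n (fun i => large_part b (f i x)) q p
    (fun i => b < `|f i x|)%R q0 p0 _ _) _.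
  - by move=> i; exact: large_part_ge0.
  - by move=> i; rewrite /large_part => /negbTE ->.
  apply: (@le_trans _ _ (((r / lam) `^ r * expR (lam * \sum_(i < n) (b < `|f i x|)%R%:R)) *
      \sum_(i < n) large_part b (f i x) `^ p)%R).
    rewrite ler_wpM2r//; first by apply: sumr_ge0 => i _; exact: powR_ge0.
    by rewrite powR_le_expR// sumr_ge0.
  rewrite -mulrA ler_wpM2l ?powR_ge0// mulr_sumr ler_sum// => k _.
  rewrite big_split/= mulr_sumr expR_sum ler_wpM2l//.
    by apply: prodr_ge0 => i _; exact: expR_ge0.
  by rewrite (bigD1 k)//= eqxx big1 ?mulr1// => i /negbTE; rewrite -val_eqE => ->.
rewrite ge0_integralZl//; last 3 first.
- exact: emeasurable_sum.
- by move=> x _; apply: sume_ge0 => k _; exact: prode_ge0.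
- by rewrite lee_fin powR_ge0.
rewrite EFinM -muleA lee_wpmul2l ?lee_fin ?powR_ge0//.
rewrite ge0_integral_sum//; last by move=> k x _; exact: prode_ge0.
rewrite ge0_sume_distrr; last first.
  by move=> k _; apply: integral_ge0 => x _; rewrite lee_fin powR_ge0.
apply: lee_sum => k _.
rewrite (integral_prod_independent mf (mweight k) (weight_ge0 k) indf).
apply: (@le_trans _ _ (\prod_(i < n) ((expR (p * exceed i))%:E *
    (if (i == k :> nat) then (p + 1)%:E * \int[P]_x (large_part b (f k x) `^ p)%:E else 1)))).
  apply: lee_prod => i; rewrite integral_weight andbT.
  by apply: integral_ge0 => x _; exact: weight_ge0.
rewrite big_split/= prodEFin -expR_sum -mulr_sumr.
have -> c : \prod_(i < n) (if i == k :> nat then c else 1) = c :> \bar R.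
  by rewrite (bigD1 k)//= eqxx big1 ?mule1// => i /negbTE; rewrite -val_eqE => ->.
rewrite EFinM [leRHS]muleAC [leLHS]muleC lee_wpmul2l//.
  rewrite mule_ge0//; first by rewrite lee_fin addr_ge0// ltW.
  by apply: integral_ge0 => x _; rewrite lee_fin powR_ge0.
rewrite lee_fin ler_expR -[leRHS]mulr1 ler_wpM2l ?(ltW p0)//.
rewrite -lee_fin -sumEFin.
by under eq_bigr do rewrite exceedE.
Qed.

Lemma small_moment_le n (S : R) : (b `^ q <= S)%R ->
  \sum_(k < n) \int[P]_x (small_part b (f k x) `^ q)%:E <= (2 * S)%:E ->
  \int[P]_x ((\sum_(i < n) small_part b (f i x) `^ q) `^ r)%R%:E <=
  ((r / lam) `^ r * (expR (p * 2) * S `^ r))%R%:E.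
Proof.
move=> bS small2S.
have Yle i x : (small_part b (f i x) `^ q <= S)%R.
  apply: le_trans bS; rewrite ge0_ler_powR ?nnegrE ?small_part_ge0 ?(ltW q0)//.
  exact: small_part_le.
(* If S = 0 the level is 0 and all small parts vanish; otherwise normalize. *)
have := powR_ge0 b q => /le_trans/(_ bS); rewrite le_eqVlt => /predU1P[S0|S0].
  rewrite (eq_integral (cst 0)); last first.
    move=> x _; rewrite big1 ?powR0 ?gt_eqF// => i _.
    by apply/eqP; rewrite eq_le powR_ge0 S0 Yle.
  by rewrite integral_cst// mul0e lee_fin !mulr_ge0 ?powR_ge0 ?expR_ge0.
pose Z i x := (small_part b (f i x) `^ q / S)%R.
have Z01 i x : (0 <= Z i x <= 1)%R.
  by rewrite divr_ge0 ?powR_ge0 ?(ltW S0)//= ler_pdivrMr// mul1r.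
have mZ i : measurable_fun setT (Z i).
  by apply: measurable_funM => //; exact: (measurableT_comp (measurable_powR _) (msmall i)).
have IZ i : \int[P]_x (Z i x)%:E = \int[P]_x (small_part b (f i x) `^ q)%:E * (S^-1)%R%:E.
  rewrite -ge0_integralZr//; last 3 first.
  - by apply/measurable_EFinP; exact: (measurableT_comp (measurable_powR _) (msmall i)).
  - by move=> x _; rewrite lee_fin powR_ge0.
  - by rewrite lee_fin invr_ge0 ltW.
pose m i := fine (\int[P]_x (Z i x)%:E).
have mE i : (m i)%:E = \int[P]_x (Z i x)%:E.
  rewrite fineK// ge0_fin_numE; last first.
    by apply: integral_ge0 => x _; rewrite lee_fin; case/andP: (Z01 i x).
  apply: (@le_lt_trans _ _ (\int[P]_x 1)).
    apply: ge0_le_integral => //.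
    - by move=> x _; rewrite lee_fin; case/andP: (Z01 i x).
    - exact/measurable_EFinP.
    - by move=> x _; rewrite lee_fin; case/andP: (Z01 i x).
  have -> : \int[P]__ 1 = 1 by rewrite integral_cst// mul1e; exact: probability_setT.
  by rewrite ltry.
have mgi (i : nat) : measurable_fun setT
    (fun y : R => (expR (lam * (small_part b y `^ q / S)))%:E).
  apply/measurable_EFinP; apply: measurableT_comp => //; apply: measurable_funM => //.
  apply: measurable_funM => //.
  exact: (measurableT_comp (measurable_powR _) (measurable_small_part b)).
have mprod : measurable_fun setT (fun x => \prod_(i < n) (expR (lam * Z i x))%:E).
  under eq_fun do rewrite prodEFin -expR_sum.
  apply/measurable_EFinP; apply: measurableT_comp => //.
  by apply: measurable_sum => i; exact: measurable_funM.
apply: (@le_trans _ _ (\int[P]_x (((r / lam) `^ r * S `^ r)%:E *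
    \prod_(i < n) (expR (lam * Z i x))%:E))).
  apply: ge0_le_integral => //.
  - by move=> x _; rewrite lee_fin powR_ge0.
  - apply/measurable_EFinP; apply: (measurableT_comp (measurable_powR _)).
    apply: measurable_sum => i.
    exact: (measurableT_comp (measurable_powR _) (msmall i)).
  - exact: emeasurable_funM.
  move=> x _; rewrite prodEFin -EFinM lee_fin -expR_sum -mulr_sumr.
  have -> : (\sum_(i < n) small_part b (f i x) `^ q = S * \sum_(i < n) Z i x)%R.
    rewrite mulr_sumr; apply: eq_bigr => i _.
    by rewrite /Z mulrCA divff ?mulr1// gt_eqF.
  have Z0 : (0 <= \sum_(i < n) Z i x)%R.
    by apply: sumr_ge0 => i _; case/andP: (Z01 i x).
  rewrite powRM ?(ltW S0)// mulrC mulrAC ler_wpM2r ?powR_ge0//.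
  exact: powR_le_expR.
rewrite ge0_integralZl//; last 2 first.
- by move=> x _; apply: prode_ge0 => i _; rewrite lee_fin expR_ge0.
- by rewrite lee_fin mulr_ge0 ?powR_ge0.
rewrite [(expR _ * _)%R]mulrC mulrA [leRHS]EFinM lee_wpmul2l ?lee_fin ?mulr_ge0 ?powR_ge0//.
rewrite (@integral_prod_independent _ _ _ P f _ mf mgi _ indf); last first.
  by move=> i y; rewrite lee_fin expR_ge0.
apply: (@le_trans _ _ (\prod_(i < n) (expR (p * m i))%:E)).
  apply: lee_prod => i; apply/andP; split.
    by apply: integral_ge0 => x _; rewrite lee_fin expR_ge0.
  rewrite -[X in (X * m i)%R](addrK 1%R) -explam.
  by apply: (exp_moment_le (mZ i) (Z01 i) (ltW lam0)); rewrite mE.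
rewrite prodEFin -expR_sum lee_fin ler_expR -mulr_sumr ler_wpM2l ?(ltW p0)//.
rewrite -lee_fin -sumEFin.
under eq_bigr do rewrite mE IZ.
rewrite -ge0_sume_distrl; last first.
  by move=> i _; apply: integral_ge0 => x _; rewrite lee_fin powR_ge0.
by rewrite lee_pdivrMr.
Qed.

End truncated_moments.

(** * The upper bound *)

Section upper_bound.
Context (R : realType).
Local Open Scope ereal_scope.

Lemma le_poweR (x y : \bar R) (r : R) : (0 <= r)%R -> 0 <= x -> x <= y ->
  x `^ r <= y `^ r.
Proof.
move=> r0 x0 xy; apply: gt0_ler_poweR => //; rewrite in_itv/= leey andbT//.
exact: le_trans xy.
Qed.

Lemma le_poweR_inv (x y : \bar R) (r : R) : (0 < r)%R -> 0 <= x -> 0 <= y ->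
  x `^ r <= y -> x <= y `^ r^-1.
Proof.
move=> r0 x0 y0 xy; rewrite -(@poweRe1 _ x)// -(divff (lt0r_neq0 r0)).
rewrite poweRrM; apply: le_poweR => //; first by rewrite invr_ge0 ltW.
exact: poweR_ge0.
Qed.

Lemma poweR_lq_norm (p q : R) (f : nat -> R -> R) (x : R) : (0 < q)%R ->
  `|lq_norm q f x| `^ p = (\sum_(k <oo) (`|f k x| `^ q)%R%:E) `^ (p / q).
Proof.
move=> q0; rewrite gee0_abs; last exact: Lnorm_ge0.
by rewrite /lq_norm Lnorm_counting// -poweRrM mulrC; congr (_ `^ _).
Qed.

Lemma measurable_poweR_lq_norm (p q : R) (f : nat -> R -> R) : (0 < q)%R ->
  (forall k, measurable_fun (setT : set R) (f k)) ->
  measurable_fun (setT : set (measurableTypeR R)) (fun x => `|lq_norm q f x| `^ p).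
Proof.
move=> q0 mf; under eq_fun do rewrite poweR_lq_norm//.
apply: (measurableT_comp (measurable_poweR _)).
apply: ge0_emeasurable_sum => [k x _ _|k _]; first by rewrite lee_fin powR_ge0.
apply/measurable_EFinP; apply: (measurableT_comp (measurable_powR _)).
exact: (measurableT_comp (@normr_measurable R setT) (mf k)).
Qed.

(** Monotone convergence reduces the bound to finitely many indices. *)
Lemma Lp_lq_norm_le (p q : R) (f : nat -> R -> R) (B : \bar R) :
  (0 < p)%R -> (0 < q)%R -> (forall k, measurable_fun (setT : set R) (f k)) ->
  (forall n, \int[@lebesgue01 R]_x
     ((\sum_(i < n) `|f i x| `^ q) `^ (p / q))%R%:E <= B) ->
  Lp_lq_norm p q f <= B `^ p^-1.
Proof.
move=> p0 q0 mf leB; have pq0 : (0 < p / q)%R by rewrite divr_gt0.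
pose s n (x : R) : R := (\sum_(i < n) `|f i x| `^ q)%R.
have s0 n x : (0 <= s n x)%R by apply: sumr_ge0 => i _; exact: powR_ge0.
have mfq k : measurable_fun (setT : set R) (fun x => `|f k x| `^ q)%R.
  apply: (measurableT_comp (measurable_powR _)).
  exact: (measurableT_comp (@normr_measurable R setT) (mf k)).
rewrite /Lp_lq_norm unlock; apply: le_poweR.
- by rewrite invr_ge0 ltW.
- by apply: integral_ge0 => x _; exact: poweR_ge0.
pose g n (x : R) : \bar R := ((s n x) `^ (p / q))%R%:E.
have nd_s x : {homo s ^~ x : n m / (n <= m)%N >-> (n <= m)%R}.
  apply/nondecreasing_seqP => n; rewrite /s big_ord_recr/= lerDl.
  exact: powR_ge0.
have nd_g x : {homo g ^~ x : n m / (n <= m)%N >-> n <= m}.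
  move=> n m nm; rewrite lee_fin ge0_ler_powR ?nnegrE// ?(ltW pq0)//.
  exact: nd_s.
have mg n : measurable_fun (setT : set (measurableTypeR R)) (g n).
  apply/measurable_EFinP; apply: (measurableT_comp (measurable_powR _)).
  by apply: measurable_sum => i; exact: mfq.
have cvg_int := @cvg_monotone_convergence _ _ _ (@lebesgue01 R) _ measurableT g mg
  (fun n x _ => powR_ge0 _ _) (fun x _ => nd_g x).
apply: (@le_trans _ _ (limn (fun n => \int[@lebesgue01 R]_x g n x))); last first.
  apply: lime_le; first by apply/cvg_ex; eexists; exact: cvg_int.
  by apply: nearW => n; exact: leB.
rewrite (cvg_lim _ cvg_int)//.
apply: ge0_le_integral => //.
- by move=> x _; exact: poweR_ge0.
- exact: measurable_poweR_lq_norm.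
- apply: (emeasurable_fun_cvg g) => // x _.
  exact: ereal_nondecreasing_is_cvgn.
move=> x _; rewrite poweR_lq_norm//.
have cg : cvgn (g ^~ x) by exact: ereal_nondecreasing_is_cvgn.
have gL n : g n x <= limn (g ^~ x).
  by apply: lime_ge => //; exists n => // m /=; exact: nd_g.
have L0 : 0 <= limn (g ^~ x) by apply: le_trans (gL 0%N); rewrite lee_fin powR_ge0.
(* Continuity of the power at the limit, possibly infinite, is replaced by the
   monotonicity of the inverse power. *)
have -> : limn (g ^~ x) = (limn (g ^~ x) `^ (p / q)^-1) `^ (p / q).
  by rewrite -poweRrM mulVf ?gt_eqF// poweRe1.
apply: le_poweR; first exact: ltW.
  by apply: nneseries_ge0 => k _ _; rewrite lee_fin powR_ge0.
apply: lime_le.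
  by apply: is_cvg_nneseries => k _ _; rewrite lee_fin powR_ge0.
apply: nearW => n; apply: le_poweR_inv => //.
  by apply: sume_ge0 => k _; rewrite lee_fin powR_ge0.
by rewrite big_mkord sumEFin poweR_EFin; exact: gL.
Qed.

(** The two moment bounds together, compared with the p-th power of the claimed
    bound: [m] stands for the L_p norm of F* on [0,1] and [s] for the sum of the
    F*(k)^q.  The factors 2^(p/q), exp(2p) and 2^p become the constants 2,
    exp(2) and 2 after the p-th root. *)
Lemma moment_bound_le_powR (p q lam m s : R) : (1 <= p)%R -> (1 <= q)%R -> (0 < lam)%R ->
  (0 <= m)%R -> (0 <= s)%R ->
  (2 `^ (p / q) * (((p / q) / lam) `^ (p / q) *
    ((p + 1) * expR p * m `^ p + expR (p * 2) * s `^ (p / q))) <=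
   ((4 * expR 2 * (p / lam) `^ q^-1) * (m + s `^ q^-1)) `^ p)%R.
Proof.
move=> p1 q1 lam0 m0 s0; set t := (s `^ q^-1)%R.
have p0 : (0 < p)%R by exact: lt_le_trans p1.
have q0 : (0 < q)%R by exact: lt_le_trans q1.
have t0 : (0 <= t)%R by exact: powR_ge0.
have rp : (p / q <= p)%R by rewrite ler_pdivrMr// ler_peMr// ltW.
have r0 : (0 <= p / q)%R by rewrite divr_ge0// ltW.
have -> : (s `^ (p / q) = t `^ p)%R by rewrite /t -powRrM mulrC.
have e1 : ((p + 1) * expR p <= expR (p * 2))%R.
  rewrite mulr_natr mulr2n expRD ler_wpM2r ?expR_ge0// addrC.
  exact: expR_ge1Dx.
have e2 : ((p + 1) * expR p * m `^ p + expR (p * 2) * t `^ p <=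
    expR (p * 2) * (2 `^ p * (m + t) `^ p))%R.
  apply: (@le_trans _ _ (expR (p * 2) * (m `^ p + t `^ p))%R).
    by rewrite [leRHS]mulrDr lerD2r ler_wpM2r ?powR_ge0.
  rewrite ler_wpM2l ?expR_ge0//.
  apply: (@le_trans _ _ (2 * (m + t) `^ p)%R); last first.
    rewrite ler_wpM2r ?powR_ge0//.
    by rewrite le1r_powR// ler1n.
  rewrite mulr_natl mulr2n lerD// ge0_ler_powR ?nnegrE ?(ltW p0) ?addr_ge0//.
    by rewrite lerDl.
  by rewrite lerDr.
have e3 : (((p / q) / lam) `^ (p / q) <= ((p / lam) `^ q^-1) `^ p)%R.
  rewrite -powRrM [(q^-1 * p)%R]mulrC ge0_ler_powR// ?nnegrE.
  - by rewrite divr_ge0// ltW.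
  - by rewrite divr_ge0// ltW.
  - by rewrite ler_wpM2r// invr_ge0 ltW.
have e4 : (2 `^ (p / q) <= 2 `^ p)%R by rewrite ler_powR// ler1n.
move: e3; have := powR_ge0 (p / q / lam) (p / q); have := powR_ge0 (p / lam) q^-1.
move: (powR (p / q / lam) (p / q)) (powR (p / lam) q^-1) => V G G0 V0 e3.
have -> : (4 * expR 2 * G * (m + t) = 2 * (G * (expR 2 * (2 * (m + t)))))%R by ring.
rewrite !powRM ?mulr_ge0 ?expR_ge0 ?addr_ge0//.
rewrite -expRM [(2 * p)%R]mulrC.
have Z0 : (0 <= (p + 1) * expR p * m `^ p + expR (p * 2) * t `^ p)%R.
  rewrite addr_ge0 ?mulr_ge0 ?powR_ge0 ?expR_ge0//.
  by rewrite addr_ge0// ltW.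
apply: ler_pM => //; [exact: mulr_ge0|exact: ler_pM].
Qed.

Lemma Lp_lq_norm_le_disjoint_norm (p q : R) (f : nat -> R -> R) (F : R -> R) :
  (1 <= p)%R -> (1 <= q)%R -> admissible p f F ->
  Lp_lq_norm p q f <= (4 * expR 2 * growth_order p q)%:E * disjoint_norm p q F.
Proof.
move=> p1 q1 [Lf indf Ff].
have p0 : (0 < p)%R by exact: lt_le_trans p1.
have q0 : (0 < q)%R by exact: lt_le_trans q1.
have lam0 : (0 < ln (p + 1))%R by rewrite ln_gt0// ltrDr.
have mf k : measurable_fun (setT : set R) (f k).
  by have := Lf k; rewrite inE => /andP[/[!inE]].
rewrite /disjoint_norm/=; set Fstar := decreasing_rearrangement _ _.
set M := Lnorm _ _ _; set S := \sum_(1 <= k <oo) _.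
have M0 : 0 <= M by exact: Lnorm_ge0.
have S0 : 0 <= S by apply: nneseries_ge0 => k _ _; exact: poweR_ge0.
have c0 : (0 < 4 * expR 2 * growth_order p q)%R.
  by rewrite !mulr_gt0 ?expR_gt0// powR_gt0// divr_gt0.
(* If the disjoint norm is infinite there is nothing to prove. *)
have [MSoo|] := eqVneq (M + S `^ q^-1) +oo.
  by rewrite MSoo muleC gt0_mulye ?leey// lte_fin.
rewrite -ltey => MSfin.
have [m ME] : exists m : R, M = m%:E.
  move: MSfin M0; case: (M) => [m _ _|+ _|//]; first by exists m.
  by rewrite addye// gt_eqF// (lt_le_trans _ (poweR_ge0 _ _)).
have [s SE] : exists s : R, S = s%:E.
  move: MSfin S0; case: (S) => [s _ _|+ _|//]; first by exists s.
  by rewrite poweRyr ?gt_eqF ?invr_gt0// addey// ME.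
have m0 : (0 <= m)%R by rewrite -lee_fin -ME.
have s0 : (0 <= s)%R by rewrite -lee_fin -SE.
have F1S : Fstar 1%R `^ q <= S.
  apply: le_trans (@nneseries_lim_ge R _ xpredT 1 2 _); last first.
    by move=> k _ _; exact: poweR_ge0.
  by rewrite big_nat1.
have [b Fb] : exists b : R, Fstar 1%R = b%:E.
  have := rearrangement_ge0 F 1%R; rewrite -/Fstar => F0.
  move: F1S F0; case: (Fstar 1%R) => [b _ _|+ _|//]; first by exists b.
  by rewrite poweRyr ?gt_eqF// SE leye_eq.
have b0 : (0 <= b)%R by rewrite -lee_fin -Fb rearrangement_ge0.
have bS : (b `^ q <= s)%R by rewrite -lee_fin -SE -poweR_EFin -Fb.
rewrite ME SE poweR_EFin -EFinD -EFinM.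
set C := (4 * _ * _ * _)%R.
have C0 : (0 <= C)%R by rewrite mulr_ge0 ?(ltW c0)// addr_ge0// powR_ge0.
have -> : C%:E = (C `^ p)%R%:E `^ p^-1.
  by rewrite poweR_EFin -powRrM divff ?gt_eqF// powRr1.
apply: Lp_lq_norm_le => // n.
have mlarge i : measurable_fun (setT : set R) (fun x => large_part b (f i x) `^ q)%R.
  apply: (measurableT_comp (measurable_powR _)).
  exact: (measurableT_comp (measurable_large_part b) (mf i)).
have msmall i : measurable_fun (setT : set R) (fun x => small_part b (f i x) `^ q)%R.
  apply: (measurableT_comp (measurable_powR _)).
  exact: (measurableT_comp (measurable_small_part b) (mf i)).
pose X x := (\sum_(i < n) large_part b (f i x) `^ q)%R.
pose Y x := (\sum_(i < n) small_part b (f i x) `^ q)%R.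
have X0 x : (0 <= X x)%R by apply: sumr_ge0 => i _; exact: powR_ge0.
have Y0 x : (0 <= Y x)%R by apply: sumr_ge0 => i _; exact: powR_ge0.
have mX : measurable_fun (setT : set (measurableTypeR R)) (fun x => (X x `^ (p / q))%R%:E).
  apply/measurable_EFinP; apply: (measurableT_comp (measurable_powR _)).
  by apply: measurable_sum => i; exact: mlarge.
have mY : measurable_fun (setT : set (measurableTypeR R)) (fun x => (Y x `^ (p / q))%R%:E).
  apply/measurable_EFinP; apply: (measurableT_comp (measurable_powR _)).
  by apply: measurable_sum => i; exact: msmall.
apply: (@le_trans _ _ (\int[@lebesgue01 R]_x
    ((2 `^ (p / q))%R%:E * ((X x `^ (p / q))%R%:E + (Y x `^ (p / q))%R%:E)))).
  apply: ge0_le_integral; first exact: measurableT.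
  - by move=> x _; rewrite lee_fin powR_ge0.
  - apply/measurable_EFinP; apply: (measurableT_comp (measurable_powR _)).
    apply: measurable_sum => i; apply: (measurableT_comp (measurable_powR _)).
    exact: (measurableT_comp (@normr_measurable R setT) (mf i)).
  - apply: emeasurable_funM; first exact: measurable_cst.
    exact: emeasurable_funD mX mY.
  move=> x _; rewrite -EFinD -EFinM lee_fin.
  have -> : (\sum_(i < n) `|f i x| `^ q = X x + Y x)%R.
    rewrite -big_split/=; apply: eq_bigr => i _.
    rewrite /large_part /small_part; case: ifP => _.
      by rewrite powR0 ?addr0 ?gt_eqF.
    by rewrite powR0 ?add0r ?gt_eqF.
  by apply: powRD_le => //; rewrite divr_ge0// ltW.
rewrite ge0_integralZl//; last 2 first.
- exact: emeasurable_funD mX mY.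
- by move=> x _; rewrite adde_ge0// lee_fin powR_ge0.
have Xr0 (x : measurableTypeR R) : [set: measurableTypeR R] x -> 0 <= (X x `^ (p / q))%R%:E.
  by rewrite lee_fin powR_ge0.
have Yr0 (x : measurableTypeR R) : [set: measurableTypeR R] x -> 0 <= (Y x `^ (p / q))%R%:E.
  by rewrite lee_fin powR_ge0.
rewrite (ge0_integralD _ measurableT Xr0 mX Yr0 mY).
have partial_le (u : nat -> \bar R) (B : \bar R) : (forall k, 0 <= u k) ->
    \sum_(k <oo) u k <= B -> \sum_(k < n) u k <= B.
  move=> u0; apply: le_trans.
  by rewrite -(big_mkord xpredT) nneseries_lim_ge.
have Pb : \sum_(i < n) @lebesgue01 R [set x | (b < `|f i x|)%R] <= 1.
  apply: (partial_le (fun i => @lebesgue01 R [set x | (b < `|f i x|)%R])) => [k|].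
    exact: measure_ge0.
  have := distribution_level_le1 Ff Fb.
  by rewrite (disjointification_distribution Ff).
have large_le : \sum_(k < n) \int[@lebesgue01 R]_x (large_part b (f k x) `^ p)%R%:E
    <= (m `^ p)%R%:E.
  apply: (partial_le (fun k => \int[@lebesgue01 R]_x (large_part b (f k x) `^ p)%R%:E)) => [k|].
    by apply: integral_ge0 => x _; rewrite lee_fin powR_ge0.
  apply: le_trans (sum_large_part_le mf Ff Fb p0) _.
  rewrite -poweR_EFin -ME /M poweR_Lnorm ?gt_eqF//.
  rewrite le_eqVlt; apply/orP; left; apply/eqP; apply: eq_integral => x _.
  by rewrite gee0_abs// mule_ge0 ?rearrangement_ge0// lee_fin.
have small_le : \sum_(k < n) \int[@lebesgue01 R]_x (small_part b (f k x) `^ q)%R%:E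
    <= (2 * s)%R%:E.
  apply: (partial_le (fun k => \int[@lebesgue01 R]_x (small_part b (f k x) `^ q)%R%:E)) => [k|].
    by apply: integral_ge0 => x _; rewrite lee_fin powR_ge0.
  by rewrite EFinM -SE; exact: (sum_small_part_le mf Ff Fb q0).
have := @large_moment_le _ _ R (@lebesgue01 R) f p q b mf indf p1 q1 n Pb.
have := @small_moment_le _ _ R (@lebesgue01 R) f p q b mf indf p1 q1 b0 n s bS small_le.
rewrite -/(X _) => Yle Xle.
apply: (@le_trans _ _ (2 `^ (p / q) * (((p / q) / ln (p + 1)) `^ (p / q) *
    ((p + 1) * expR p * m `^ p + expR (p * 2) * s `^ (p / q))))%R%:E); last first.
  by rewrite lee_fin; exact: moment_bound_le_powR.
rewrite EFinM lee_wpmul2l ?lee_fin ?powR_ge0//.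
rewrite mulrDr EFinD leeD//.
apply: (le_trans Xle).
rewrite [in leRHS]mulrA [leRHS]EFinM lee_wpmul2l//.
by rewrite lee_fin !mulr_ge0 ?powR_ge0 ?expR_ge0// addr_ge0// ltW.
Qed.

End upper_bound.

(** * Independent events on the unit interval *)

Section uniform_sample.
Context (R : realType).
Local Open Scope ereal_scope.

Lemma uniform_ordinal M : exists tau : R -> 'I_M.+1,
  forall j, measurable (tau @^-1` [set j]) /\
    @lebesgue01 R (tau @^-1` [set j]) = (M.+1%:R^-1)%R%:E.
Proof.
have N0 : (0 < M.+1%:R :> R)%R by rewrite ltr0n.
pose tau (t : R) : 'I_M.+1 :=
  if t \in `[0%R, 1%R] then inord (minn (Num.truncn (t * M.+1%:R)) M) else ord0.
(* The last cell is closed so that the cells cover [0, 1] exactly. *)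
pose cell (j : 'I_M.+1) : interval R :=
  Interval (BLeft (j%:R / M.+1%:R)%R) (BSide (j < M)%N (j.+1%:R / M.+1%:R)%R).
have cellP t j : t \in `[0%R, 1%R] -> (tau t == j) = (t \in cell j).
  rewrite /tau => t01; rewrite t01; move: t01; rewrite in_itv/= => /andP[t0 t1].
  have tN0 : (0 <= t * M.+1%:R)%R by rewrite mulr_ge0.
  have tr : (minn (Num.truncn (t * M.+1%:R)) M < M.+1)%N by rewrite ltnS geq_minr.
  rewrite -val_eqE /= inordK// in_itv/=.
  rewrite ler_pdivrMr// -truncn_ge_nat//.
  have := ltn_ord j; rewrite ltnS leq_eqVlt => /predU1P[jM|jM].
    rewrite jM ltnn/= divff ?pnatr_eq0// t1 andbT.
    by rewrite eqn_leq geq_minr/= leq_min leqnn andbT.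
  rewrite jM /= ltr_pdivlMr// -truncn_le_nat.
  rewrite /minn; case: ltnP => [_|Mt]; first by rewrite eqn_leq andbC.
  rewrite gtn_eqF//; apply/esym/negbTE; rewrite negb_and -!ltnNge.
  by rewrite (leq_trans jM Mt) orbT.
have cell01 j : [set` cell j] `<=` `[0%R, 1%R].
  move=> t /=; rewrite !in_itv/= => /andP[jt tj].
  rewrite (le_trans _ jt) ?divr_ge0//=.
  apply: (@le_trans _ _ (j.+1%:R / M.+1%:R)%R).
    by move: tj; case: (j < M)%N => //= /ltW.
  by rewrite ler_pdivrMr// mul1r ler_nat.
exists tau => j.
have tauE : tau @^-1` [set j] =
    [set` cell j] `|` ((if j == ord0 then setT else set0) `&` ~` `[0%R, 1%R]).
  apply/seteqP; split=> t /=.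
    have [t01|t01] := boolP (t \in `[0%R, 1%R]).
      by move=> /eqP; rewrite cellP//; left.
    rewrite /tau (negbTE t01) => <-; right; split; first by rewrite eqxx.
    by apply/negP.
  case=> [tj|[]]; first by apply/eqP; rewrite (cellP _ _ (cell01 j t tj)).
  by case: eqP => // -> _ /negP; rewrite /tau => /negbTE ->.
split.
  rewrite tauE; apply: measurableU => //; apply: measurableI.
    by case: ifP.
  exact: measurableC.
rewrite /lebesgue01 /mrestr tauE setIUl -setIA setICl setI0 setU0.
rewrite (setIidl (cell01 j)) lebesgue_measure_itv/= lte_fin.
rewrite ltr_pM2r ?invr_gt0// ltr_nat ltnSn -EFinB -mulrBl -natrB// subSnn.
by rewrite mul1r.
Qed.

(** Applied to a type of finite functions, this yields finitely many independent
    uniform variables as the coordinates of one uniform variable. *)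
Lemma uniform_finType (X : finType) : (0 < #|X|)%N -> exists w : R -> X,
  forall G : pred X, measurable (w @^-1` [set x | G x]) /\
    @lebesgue01 R (w @^-1` [set x | G x]) = (\sum_(x | G x) #|X|%:R^-1)%R%:E.
Proof.
case XE : #|X| => [//|M] _; have [tau tauP] := uniform_ordinal M.
pose e (j : 'I_M.+1) : X := enum_val (cast_ord (esym XE) j).
pose e' (x : X) : 'I_M.+1 := cast_ord XE (enum_rank x).
have eK : cancel e e' by move=> j; rewrite /e /e' enum_valK cast_ordKV.
have e'K : cancel e' e by move=> x; rewrite /e /e' cast_ordK enum_rankK.
exists (e \o tau) => G.
have mtau (A : set 'I_M.+1) : measurable (tau @^-1` A).
  rewrite (_ : _ @^-1` _ = \big[setU/set0]_(j : 'I_M.+1 | `[< A j >]) (tau @^-1` [set j])).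
    by apply: bigsetU_measurable => j _; exact: (tauP j).1.
  apply/seteqP; split=> t /=.
    move=> At; rewrite -bigcup_seq_cond; exists (tau t) => //=.
    by rewrite mem_index_enum; exact/asboolP.
  by rewrite -bigcup_seq_cond => -[j /= /andP[_ /asboolP Aj] ->].
have mG := mtau (e @^-1` [set x | G x]); split => //.
rewrite -[X in lebesgue01 X]setIT -integral_indic//.
transitivity (\int[@lebesgue01 R]_t \sum_(x <- enum G) (\1_(tau @^-1` [set e' x]) t)%:E).
  apply: eq_integral => t _; rewrite sumEFin; congr _%:E; rewrite big_enum/=.
  rewrite indicE; case: (boolP (G (e (tau t)))) => Gt.
    rewrite mem_set// (bigD1 (e (tau t)))//= indicE mem_set/=; last by rewrite eK.
    rewrite big1 ?addr0// => x /andP[_ xt]; rewrite indicE memNset//= => tx.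
    by move: xt; rewrite tx e'K eqxx.
  rewrite memNset/=; last exact/negP.
  rewrite big1// => x Gx; rewrite indicE memNset//= => tx.
  by move: Gt; rewrite tx e'K => /negP[].
rewrite ge0_integral_sum//; last first.
  by move=> x; apply/measurable_EFinP/measurable_indic; exact: (tauP (e' x)).1.
rewrite big_enum/= -sumEFin; apply: eq_bigr => x _.
rewrite integral_indic ?setIT//; first exact: (tauP (e' x)).2.
exact: (tauP (e' x)).1.
Qed.

Lemma uniform_coordinates n : exists w : R -> 'I_n.+1 -> 'I_n.+1,
  forall B : 'I_n.+1 -> pred 'I_n.+1,
    measurable [set t | forall i, B i (w t i)] /\
    @lebesgue01 R [set t | forall i, B i (w t i)] =
    (\prod_(i < n.+1) (#|B i|%:R / n.+1%:R))%R%:E.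
Proof.
have X0 : (0 < #|{ffun 'I_n.+1 -> 'I_n.+1}|)%N.
  by rewrite card_ffun card_ord expn_gt0.
have [w wP] := uniform_finType X0.
exists (fun t i => w t i) => B.
have := wP (fun x : {ffun 'I_n.+1 -> 'I_n.+1} => [forall i, B i (x i)]).
rewrite (_ : _ @^-1` _ = [set t | forall i, B i (w t i)]); last first.
  by apply/seteqP; split=> t /=; [move/forallP|move=> ?; apply/forallP].
move=> [mB ->]; split => //; congr _%:E.
rewrite card_ffun card_ord.
under [RHS]eq_bigr => i _.
  rewrite -sum1_card natr_sum mulr_suml big_mkcond/=.
  over.
rewrite bigA_distr_bigA/= big_mkcond/=; apply: eq_bigr => x _.
case: ifPn => [/forallP Bx|/forallPn[i Bx]].
  under eq_bigr do rewrite [_ \in _]Bx mul1r.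
  by rewrite prodr_const card_ord natrX exprVn.
by rewrite (bigD1 i)//= [_ \in _](negbTE Bx) mul0r.
Qed.

End uniform_sample.

(** The product rule for the first [n] variables, with whole spaces among the
    sets [A k], contains the product rule for all their subfamilies; a constant
    variable contributes a factor 0 or 1. *)
Lemma independent_finitely_many (R : realType) d (T : measurableType d)
    (P : probability T R) (n : nat) (f : nat -> T -> R) :
  (forall k, (n <= k)%N -> f k = cst 0) ->
  (forall A : nat -> set R, (forall k, measurable (A k)) ->
     P [set t | forall i, (i < n)%N -> A i (f i t)] =
     (\prod_(i < n) P (f i @^-1` A i))%E) ->
  independent_variables P f.
Proof.
move=> f0 prodP J A mA.
have PT : P setT = 1%E by exact: probability_setT.
have [[k [kJ nk Ak]]|noex] :=
    pselect (exists k, [/\ k \in J, (n <= k)%N & ~ A k 0]).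
  have fA0 : f k @^-1` A k = set0 by rewrite f0//; apply/seteqP; split.
  rewrite (_ : \bigcap_(k in _) _ = set0); last first.
    apply/seteqP; split => // t /(_ k kJ).
    by rewrite fA0.
  by rewrite measure0 (big_fsetD1 k)//= fA0 measure0 mul0e.
have A0 k : k \in J -> (n <= k)%N -> f k @^-1` A k = setT.
  move=> kJ nk; rewrite f0//; apply/seteqP; split => // t _ /=.
  by apply: contrapT => nA; apply: noex; exists k.
pose B k := if k \in J then A k else setT.
have mB k : measurable (B k) by rewrite /B; case: ifP.
transitivity (P [set t | forall i, (i < n)%N -> B i (f i t)]).
  congr (P _); apply/seteqP; split=> t /= H k.
    by move=> kn; rewrite /B; case: ifP => // kJ; exact: (H k kJ).
  move=> kJ; have [kn|nk] := ltnP k n.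
    by have := H k kn; rewrite /B (kJ : k \in J).
  by rewrite A0.
rewrite prodP// (bigID (fun k => (k < n)%N))/= [X in (_ * X)%E]big1_seq ?mule1; last first.
  by move=> k /andP[]; rewrite -leqNgt => nk kJ; rewrite A0.
rewrite -[in RHS]big_filter.
have -> : (\prod_(i < n) P (f i @^-1` B i) = \prod_(0 <= i < n) P (f i @^-1` B i))%E.
  by rewrite big_mkord.
transitivity (\prod_(k <- [seq k <- index_iota 0 n | k \in J]) P (f k @^-1` A k))%E.
  rewrite big_filter [RHS]big_mkcond/=; apply: eq_bigr => k _.
  by rewrite /B; case: ifP.
apply: perm_big; apply: uniq_perm.
- by rewrite filter_uniq// iota_uniq.
- by rewrite filter_uniq// fset_uniq.
- by move=> k; rewrite !mem_filter mem_index_iota andbC.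
Qed.

(** * The extremal example *)

Section extremal_example.
Context (R : realType) (n : nat).
Local Open Scope ereal_scope.
Let N := n.+1.

Let exists_indicators : exists f : nat -> R -> R,
  [/\ forall k, measurable_fun (setT : set R) (f k),
      forall k t, f k t = 0%R \/ f k t = 1%R,
      forall k, (N <= k)%N -> f k = cst 0%R,
      forall A : nat -> set R, (forall k, measurable (A k)) ->
        @lebesgue01 R [set t | forall i, (i < N)%N -> A i (f i t)] =
        \prod_(i < N) @lebesgue01 R (f i @^-1` A i) &
      forall k, (k < N)%N -> @lebesgue01 R (f k @^-1` [set 1%R]) = (N%:R^-1)%R%:E].
Proof.
have [w wP] := @uniform_coordinates R n.
pose f k t : R := ((k < N)%N && (w t (inord k) == ord0))%:R.
have fA (k : nat) (A : set R) : (k < N)%N ->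
    measurable (f k @^-1` A) /\ @lebesgue01 R (f k @^-1` A) =
    (#|[pred v : 'I_N | `[< A (v == ord0)%:R >] ]|%:R / N%:R)%R%:E.
  move=> kN; have := wP (fun i => if i == inord k :> 'I_N
    then [pred v : 'I_N | `[< A (v == ord0)%:R >] ] else predT).
  rewrite (_ : [set t | _] = f k @^-1` A); last first.
    apply/seteqP; split=> t /=.
      by move=> /(_ (inord k)); rewrite eqxx /f kN/= => /asboolP.
    rewrite /f kN/= => At i; case: eqP => // ->; exact/asboolP.
  move=> [mA ->]; split => //; rewrite (bigD1 (inord k))//= eqxx big1 ?mulr1//.
  move=> i /negbTE ->; rewrite (eq_card (B := predT))// cardT size_enum_ord divff//.
have f01 k t : f k t = 0%R \/ f k t = 1%R.
  by rewrite /f; case: (_ && _); [right|left].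
have f0 k : (N <= k)%N -> f k = cst 0%R.
  by move=> Nk; apply/funext => t; rewrite /f ltnNge Nk.
exists f; split => //.
- move=> k; have [kN|/f0 ->] := ltnP k N; last exact: measurable_cst.
  by move=> _ A mA; rewrite setTI; exact: (fA k A kN).1.
- move=> A mA.
  have := wP (fun i => [pred v : 'I_N | `[< A i (v == ord0)%:R >] ]).
  rewrite (_ : [set t | _] = [set t | forall i, (i < N)%N -> A i (f i t)]); last first.
    apply/seteqP; split=> t /= H i.
      move=> iN; have := H (inord i); rewrite /= inordK// /f iN/=.
      by move/asboolP.
    apply/asboolP; have := H i (ltn_ord i).
    by rewrite /f ltn_ord/= inord_val.
  move=> [_ ->]; rewrite -prodEFin; apply: eq_bigr => i _.
  by have [_ ->] := fA i (A i) (ltn_ord i).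
- move=> k kN; have [_ ->] := fA k [set 1%R] kN.
  rewrite (eq_card (B := pred1 ord0)) ?card1 ?mul1r// => v.
  rewrite !inE; apply/asboolP/eqP => [|->]; last by rewrite eqxx.
  by case: eqP => //= _ /esym/eqP; rewrite oner_eq0.
Qed.

(** The disjoint copies live on intervals starting at distinct integers. *)
Let fbar (k : nat) (t : R) : R :=
  ((k < N)%N && (t \in `]k%:R, (k%:R + N%:R^-1)]))%:R%R.

Let N0 : (0 < N%:R :> R)%R. Proof. by rewrite ltr0n. Qed.

Let fbarE k : (k < N)%N -> fbar k = \1_(`]k%:R, (k%:R + N%:R^-1)%R]%classic).
Proof. by move=> kN; apply/funext => t; rewrite /fbar kN indicE mem_setE. Qed.

Let fbar0 k : (N <= k)%N -> fbar k = cst 0%R.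
Proof. by move=> Nk; apply/funext => t; rewrite /fbar ltnNge Nk. Qed.

Let fbar_tail k (s : R) : (0 <= s)%R ->
  distribution_function (@lebesgue0y R) (fbar k) s =
  (if (k < N)%N && (s < 1)%R then N%:R^-1 else 0)%R%:E.
Proof.
move=> s0; rewrite /distribution_function /lebesgue0y /mrestr.
case: ifPn => [/andP[kN s1]|ks].
  transitivity (@lebesgue_measure R `]k%:R, (k%:R + N%:R^-1)%R]%classic).
    congr (lebesgue_measure _); apply/seteqP; split=> t /=; rewrite /fbar kN/=.
      by case: (t \in _) => -[] //; rewrite normr0 ltNge s0.
    move=> tk; rewrite tk normr1; split => //.
    by move: tk; rewrite !in_itv/= andbT => /andP[+ _]; exact: le_lt_trans.
  rewrite lebesgue_measure_itv/= lte_fin ltrDl invr_gt0 N0.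
  by rewrite -EFinB addrAC subrr add0r.
transitivity (@lebesgue_measure R set0); last by rewrite measure0.
congr (lebesgue_measure _); apply/seteqP; split=> t //= -[st _].
move: ks st; rewrite negb_and /fbar; case: (k < N)%N => /= [s1|_].
  by case: (t \in _); rewrite ?normr0 ?normr1 ?(negbTE s1)// ltNge s0.
by rewrite normr0 ltNge s0.
Qed.

Let fbar_disjoint : trivIset setT (fun k => [set t : R | (0 < t)%R /\ fbar k t != 0%R]).
Proof.
have fbarP k t : fbar k t != 0%R -> (k%:R < t <= k.+1%:R)%R.
  rewrite /fbar; case: (k < N)%N; rewrite ?eqxx//=.
  case: (boolP (t \in _)); rewrite ?eqxx// in_itv/= => /andP[-> tk] _ /=.
  rewrite (le_trans tk)// -natr1 lerD2l invf_le1// -[leLHS]/(1%:R)%R ler_nat.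
  by [].
move=> i j _ _ [t [[_ /fbarP/andP[it ti]] [_ /fbarP/andP[jt tj]]]].
have := lt_le_trans it tj; have := lt_le_trans jt ti.
by rewrite !ltr_nat !ltnS => ji ij; apply/eqP; rewrite eqn_leq ij ji.
Qed.

(** [N] independent indicators of probability 1 / N, followed by zeros. *)
Lemma extremal_example (p : R) : (0 < p)%R -> exists (f : nat -> R -> R) (F : R -> R),
  [/\ admissible p f F,
      forall k (s : R), (0 <= s)%R -> distribution_function (@lebesgue01 R) (f k) s =
         (if (k < N)%N && (s < 1)%R then N%:R^-1 else 0)%R%:E &
      @lebesgue01 R [set t | forall i, (i < N)%N -> f i t = 1%R] = (N%:R ^- N)%R%:E].
Proof.
move=> p0; have [f [mf f01 f0 fprod f1]] := exists_indicators.
pose F t : R := (\sum_(0 <= k < N) fbar k t)%R.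
have distr k s : (0 <= s)%R -> distribution_function (@lebesgue01 R) (f k) s =
    (if (k < N)%N && (s < 1)%R then N%:R^-1 else 0)%R%:E.
  move=> s0; rewrite /distribution_function.
  case: ifPn => [/andP[kN s1]|ks].
    rewrite -(f1 k kN); congr (lebesgue01 _); apply/seteqP; split=> t /=.
      by case: (f01 k t) => -> //; rewrite normr0 ltNge s0.
    by move=> ->; rewrite normr1.
  rewrite (_ : [set _ | _] = set0) ?measure0//; apply/seteqP; split=> t //=.
  move: ks; rewrite negb_and -leqNgt => /orP[Nk|s1].
    by rewrite (f0 _ Nk) normr0 ltNge s0.
  by case: (f01 k t) => ->; rewrite ?normr0 ?normr1 ?(negbTE s1)// ltNge s0.
exists f, F; split => //; last first.
  rewrite (fprod (fun=> [set 1%R])) => [|k]; last exact: measurable_set1.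
  under eq_bigr do rewrite f1//.
  by rewrite prodEFin prodr_const card_ord exprVn.
split.
- move=> k; rewrite inE; apply/andP; split; rewrite inE; first exact: mf.
  rewrite /finite_norm unlock; apply: poweR_lty.
  apply: (@le_lt_trans _ _ (\int[@lebesgue01 R]_x 1)).
    apply: ge0_le_integral => //.
    + by move=> x _; exact: poweR_ge0.
    + apply: (measurableT_comp (measurable_poweR _)).
      apply: measurableT_comp => //; apply/measurable_EFinP; exact: mf.
    + move=> x _ /=; case: (f01 k x) => ->; rewrite ?normr0 ?normr1 ?powR1//.
      by rewrite powR0 ?gt_eqF.
  have -> : \int[@lebesgue01 R]__ 1 = 1.
    by rewrite integral_cst// mul1e; exact: probability_setT.
  by rewrite ltry.
- exact: (@independent_finitely_many _ _ _ _ N).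
exists fbar; split.
- move=> k; apply: measurable_funTS; have [kN|/fbar0 ->] := ltnP k N.
    by rewrite fbarE//; exact: measurable_indic.
  exact: measurable_cst.
- exact: fbar_disjoint.
- by move=> k s s0; rewrite distr// fbar_tail.
- move=> t t0; apply: cvg_near_cst; near=> m.
  rewrite /series/= (big_cat_nat _ (n := N))//=; last by near: m; exact: nbhs_infty_ge.
  rewrite [X in (_ + X)%R]big1_seq ?addr0// => k /=.
  by rewrite mem_index_iota => /andP[Nk _]; rewrite fbar0.
Unshelve. all: by end_near. Qed.

End extremal_example.

Section lower_bound.
Context (R : realType).
Local Open Scope ereal_scope.

(** Here D is the indicator of [0,1), hence F* <= 1 and F*(k) = 0 for k >= 1. *)
Lemma extremal_disjoint_norm_le1 (p q : R) (n : nat) (f : nat -> R -> R) (F : R -> R) :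
  (0 < p)%R -> (0 < q)%R -> disjointification f F ->
  (forall k (s : R), (0 <= s)%R -> distribution_function (@lebesgue01 R) (f k) s =
     (if (k < n.+1)%N && (s < 1)%R then n.+1%:R^-1 else 0)%R%:E) ->
  disjoint_norm p q F <= 1.
Proof.
move=> p0 q0 Ff distr; rewrite /disjoint_norm/=.
set Fstar := decreasing_rearrangement _ _.
have DE s : (0 <= s)%R -> distribution_function (@lebesgue0y R) F s =
    (if (s < 1)%R then 1 else 0)%R%:E.
  move=> s0; rewrite (disjointification_distribution Ff)//.
  rewrite (@nneseries_split _ _ 0 n.+1)//.
  rewrite add0n [X in _ + X]eseries0 ?adde0; last first.
    by move=> k nk _; rewrite distr// ltnNge nk.
  rewrite big_mkord; under eq_bigr do rewrite distr// ltn_ord/=.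
  rewrite sumEFin sumr_const card_ord; congr _%:E; case: ifP => _.
    by rewrite -[LHS]mulr_natr mulVf// pnatr_eq0.
  by rewrite mul0rn.
have F0 t : 0 <= Fstar t by exact: rearrangement_ge0.
have F_gt1 t : (1 <= t)%R -> Fstar t = 0.
  move=> t1; apply/eqP; rewrite eq_le F0 andbT leNgt.
  by rewrite (rearrangement_gt Ff t (lexx 0%R)) DE// ltr01 lte_fin -leNgt.
have F_le1 t : (0 <= t)%R -> Fstar t <= 1.
  move=> t0; rewrite leNgt (rearrangement_gt Ff t ler01) DE ?ler01// ltxx.
  by rewrite lte_fin -leNgt.
rewrite eseries0; last first.
  by move=> k k1 _; rewrite F_gt1 ?poweR0r ?gt_eqF// ler1n.
rewrite poweR0r ?gt_eqF ?invr_gt0// adde0 unlock.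
apply: (@le_trans _ _ (1 `^ p^-1)); last by rewrite poweR1r.
apply: le_poweR; first by rewrite invr_ge0 ltW.
  by apply: integral_ge0 => t _; exact: poweR_ge0.
apply: (@le_trans _ _ (\int[@lebesgue_measure R]_t (\1_(`[0%R, 1%R]%classic) t)%:E)).
  apply: ge0_le_integral => //.
  - by move=> t _; exact: poweR_ge0.
  - apply: (measurableT_comp (measurable_poweR _)).
    by apply: measurableT_comp => //; exact: (measurable_rearrangement01 Ff).
  - by apply/measurable_EFinP; exact: measurable_indic.
  move=> t _; rewrite indicE; case: (boolP (t \in _)) => t01; last first.
    by rewrite mule0 abse0 poweR0r// gt_eqF.
  rewrite mule1 gee0_abs// -[leRHS](poweR1r p); apply: le_poweR => //; first exact: ltW.
  by apply: F_le1; move: t01; rewrite inE/= in_itv/= => /andP[].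
rewrite integral_indic// setIT -[leLHS]/(@lebesgue_measure R `[0%R, 1%R]%classic).
by rewrite lebesgue_measure_itv/= lte_fin ltr01 oppr0 adde0.
Qed.

(** Only the event on which all indicators equal 1 is taken into account. *)
Lemma extremal_Lp_lq_norm_ge (p q : R) (n : nat) (f : nat -> R -> R) :
  (0 < p)%R -> (0 < q)%R -> (forall k, measurable_fun (setT : set R) (f k)) ->
  @lebesgue01 R [set t | forall i, (i < n)%N -> f i t = 1%R] = (n%:R ^- n)%R%:E ->
  ((n%:R `^ (p / q) * n%:R ^- n) `^ p^-1)%R%:E <= Lp_lq_norm p q f.
Proof.
move=> p0 q0 mf; set E := [set _ | _] => PE.
have mE : measurable (E : set (measurableTypeR R)).
  rewrite (_ : E = \bigcap_(i in `I_n) f i @^-1` [set 1%R]).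
    apply: fin_bigcap_measurable => [|i _]; first exact: finite_II.
    by rewrite -[X in measurable X]setTI; exact: mf.
  by apply/seteqP; split.
rewrite /Lp_lq_norm unlock -poweR_EFin; apply: le_poweR.
- by rewrite invr_ge0 ltW.
- by rewrite lee_fin mulr_ge0 ?powR_ge0// invr_ge0 exprn_ge0.
rewrite EFinM -PE -[X in lebesgue01 X]setIT -integral_indic// -ge0_integralZl//; last first.
  by apply/measurable_EFinP; exact: measurable_indic.
apply: ge0_le_integral => //.
- by apply: emeasurable_funM => //; apply/measurable_EFinP; exact: measurable_indic.
- exact: measurable_poweR_lq_norm.
move=> t _; rewrite indicE; case: (boolP (t \in E)) => tE; last first.
  by rewrite mule0 poweR_ge0.
rewrite mule1 poweR_lq_norm// -poweR_EFin; apply: le_poweR => //.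
  by rewrite divr_ge0// ltW.
apply: le_trans (@nneseries_lim_ge R _ xpredT 0 n _); last first.
  by move=> k _ _; rewrite lee_fin powR_ge0.
rewrite big_mkord sumEFin lee_fin -[n in leLHS](card_ord n) -sumr_const ler_sum// => i _.
by move: tE; rewrite inE => ->//; rewrite normr1 powR1.
Qed.

(** Take n + 1 to be the integer part N of x = p / L with L = ln (p + 1).  Then
    x / 2 <= N, and N ln N <= x L = p gives N^N <= exp(p).  The assumption on
    [p] ensures L >= 1, hence N <= x <= p + 1 and ln N <= L. *)
Lemma growth_order_le (p q : R) : (expR 1 <= p)%R -> (1 <= q)%R ->
  exists n : nat, ((2 * expR 1)^-1 * growth_order p q <=
    (n.+1%:R `^ (p / q) * n.+1%:R ^- n.+1) `^ p^-1)%R.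
Proof.
move=> pe q1; rewrite /growth_order; set L := ln (p + 1).
have q0 : (0 < q)%R by exact: lt_le_trans q1.
have p0 : (0 < p)%R by apply: lt_le_trans pe; exact: expR_gt0.
have L1 : (1 <= L)%R.
  rewrite -(expRK 1%R) /L ler_ln ?posrE ?expR_gt0 ?addr_gt0//.
  by rewrite (le_trans pe)// lerDl.
have L0 : (0 < L)%R by exact: lt_le_trans L1.
have Lp : (L <= p)%R.
  by rewrite -ler_expR lnK ?posrE ?addr_gt0// addrC expR_ge1Dx.
set x := (p / L)%R.
have x1 : (1 <= x)%R by rewrite ler_pdivlMr// mul1r.
have x0 : (0 < x)%R by exact: lt_le_trans x1.
have t0 : (0 < Num.truncn x)%N by rewrite truncn_gt0.
exists (Num.truncn x).-1; rewrite prednK//.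
have /andP[tx xt] := truncn_itv (ltW x0); set N := Num.truncn x in t0 tx xt *.
have N0 : (0 < N%:R :> R)%R by rewrite ltr0n.
have NN : (N%:R ^+ N <= expR p)%R.
  rewrite -{1}(lnK N0) -expRM_natl ler_expR.
  apply: (@le_trans _ _ (x * L)%R); last by rewrite divfK// gt_eqF.
  apply: ler_pM => //; first by rewrite ln_ge0// ler1n.
  rewrite ler_ln ?posrE ?addr_gt0// (le_trans tx)//.
  by rewrite /x ler_pdivrMr// (@le_trans _ _ (p + 1)%R) ?lerDl// ler_peMr// ltW// addr_gt0.
have xN : (x / 2 <= N%:R)%R.
  rewrite ler_pdivrMr// (le_trans (ltW xt))// -natr1 mulr_natr mulr2n lerD2l.
  by rewrite ler1n.
have e0 : (0 <= (2 * expR 1)^-1 :> R)%R by rewrite invr_ge0 mulr_ge0 ?expR_ge0.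
have -> : ((2 * expR 1)^-1 * x `^ q^-1 =
    ((((2 * expR 1)^-1 * x `^ q^-1) `^ p) `^ p^-1))%R.
  by rewrite -powRrM divff ?gt_eqF// powRr1// mulr_ge0 ?powR_ge0.
rewrite ge0_ler_powR ?nnegrE ?powR_ge0 ?invr_ge0 ?(ltW p0)//.
apply: (@le_trans _ _ ((x / 2) `^ (p / q) * expR (- p))%R); last first.
  apply: ler_pM; rewrite ?powR_ge0 ?expR_ge0//.
    apply: ge0_ler_powR; rewrite ?nnegrE ?(ltW N0)//.
      by rewrite divr_ge0 ?(ltW p0) ?(ltW q0).
    by rewrite divr_ge0 ?(ltW x0).
  by rewrite expRN lef_pV2 ?posrE ?expR_gt0 ?exprn_gt0.
have -> : ((x / 2) `^ (p / q) * expR (- p) = ((x / 2) `^ q^-1 * expR (- 1)) `^ p)%R.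
  by rewrite [RHS]powRM ?powR_ge0 ?expR_ge0// -powRrM -expRM mulN1r [(_^-1 * p)%R]mulrC.
apply: ge0_ler_powR; rewrite ?nnegrE ?mulr_ge0 ?powR_ge0 ?expR_ge0 ?(ltW p0)//.
rewrite invfM -expRN mulrC mulrA ler_wpM2r ?expR_ge0//.
rewrite powRM ?(ltW x0)// ler_wpM2l ?powR_ge0//.
apply: ger1_powR; last by rewrite invf_le1.
by rewrite invr_gt0 ltr0n invf_le1 ?ltr0n// ler1n.
Qed.

End lower_bound.

Theorem theorem13 (R : realType) :
  (exists2 alpha : R, 0 < alpha &
    forall (p q : R), 1 <= p -> 1 <= q ->
    forall (f : nat -> R -> R) (F : R -> R), admissible p f F ->
      (Lp_lq_norm p q f <= (alpha * growth_order p q)%:E * disjoint_norm p q F)%E)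
  /\
  (forall q : R, 1 <= q ->
    exists2 c : R, 0 < c &
      \forall p \near +oo%R,
        forall K : R, K < c * growth_order p q ->
        exists (f : nat -> R -> R) (F : R -> R),
          admissible p f F /\
          ~ (Lp_lq_norm p q f <= K%:E * disjoint_norm p q F)%E).
Proof.
split.
  exists (4 * expR 2); first by rewrite mulr_gt0// expR_gt0.
  by move=> p q p1 q1 f F; exact: Lp_lq_norm_le_disjoint_norm.
move=> q q1; exists (2 * expR 1)^-1; first by rewrite invr_gt0 mulr_gt0// expR_gt0.
near=> p => K Kc.
have pe : expR 1 <= p by near: p; apply: nbhs_pinfty_ge; exact: num_real.
have p0 : 0 < p by apply: lt_le_trans pe; exact: expR_gt0.
have q0 : 0 < q by exact: lt_le_trans q1.
have [n gn] := growth_order_le pe q1.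
have [f [F [adm distr PE]]] := @extremal_example R n p p0.
exists f, F; split => //; apply/negP; rewrite -ltNge.
have [Lf _ Ff] := adm.
have mf k : measurable_fun (setT : set R) (f k).
  by have := Lf k; rewrite inE => /andP[/[!inE]].
have dn1 := extremal_disjoint_norm_le1 p0 q0 Ff distr.
apply: (lt_le_trans _ (extremal_Lp_lq_norm_ge p0 q0 mf PE)).
apply: (@lt_le_trans _ _ ((2 * expR 1)^-1 * growth_order p q)%:E); last by rewrite lee_fin.
have dn0 : (0 <= disjoint_norm p q F)%E.
  by rewrite adde_ge0 ?Lnorm_ge0// poweR_ge0.
have [K0|K0] := leP 0 K.
  apply: (@le_lt_trans _ _ K%:E); last by rewrite lte_fin.
  by rewrite -[leRHS]mule1 lee_wpmul2l.
apply: (@le_lt_trans _ _ 0%E); first by rewrite mule_le0_ge0// lee_fin ltW.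
rewrite lte_fin mulr_gt0 ?invr_gt0 ?mulr_gt0 ?expR_gt0//.
by rewrite powR_gt0// divr_gt0// ln_gt0// ltrDr.
Unshelve. all: by end_near. Qed.
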